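(* Let $H_n=1+\frac12+\dots+\frac1n$ and, for $\operatorname{Re} s>0$, $$u(s)=\sum_{n=1}^{\infty}\frac{(-1)^{n-1}}{n^s}H_n .$$ Then $u$ extends to an entire function on $\mathbb{C}$. Moreover, $u(0)=\frac12\ln 2$, and for every integer $n\ge 1$, $$2u(-2n)=\eta(1-2n)+nE_{2n-1}(0),\qquad\text{equivalently}\qquad u(-2n)=\frac{(2^{2n}-1)(1-2n)}{4n}B_{2n}.$$ Also $u(-1)=\frac14-\frac14\ln 2$, and for every integer $n\ge 2$, $$2u(1-2n)=\sum_{m=0}^{n-1}\frac{(2n-1)(2n-2)\cdots(2n-1-2m)}{(2m+1)!}\,E_{2m+1}(0)\,\eta(3-2n+2m),$$ that is, $$2u(1-2n)=E_1(0)(2n-1)\eta(3-2n)+\frac{1}{3!}E_3(0)(2n-1)(2n-2)(2n-3)\eta(5-2n)+\dots+E_{2n-1}(0)\eta(1).$$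
   Context: $\eta(s)=\sum_{n\ge1}(-1)^{n-1}n^{-s}$ for $\operatorname{Re}s>0$, extended to an entire function via $\eta(s)=(1-2^{1-s})\zeta(s)$, where $\zeta$ is the Riemann zeta function; in particular $\eta(1)=\ln 2$. The Euler polynomials $E_n(x)$ are defined by $\frac{2e^{xt}}{e^t+1}=\sum_{n\ge0}E_n(x)\frac{t^n}{n!}$ ($|t|<\pi$). The Bernoulli numbers $B_n$ are defined by $\frac{t}{e^t-1}=\sum_{n\ge0}B_n\frac{t^n}{n!}$ (so $B_1=-\frac12$). *)

(* Defs.v *)
From Stdlib Require Import Reals Factorial.
From Coquelicot Require Import Coquelicot.
Open Scope R_scope.

Definition Cexp (z : C) : C :=
  (exp (Re z) * cos (Im z), exp (Re z) * sin (Im z)).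

(* x^s for a real base x > 0, with the real logarithm of x. *)
Definition Rcpow (x : R) (s : C) : C := Cexp (Cmult s (RtoC (ln x))).

(* [ex_derive] is taken over the field C, i.e. this is complex
   differentiability. *)
Definition entire (f : C -> C) : Prop :=
  forall z : C, ex_derive (K := C_AbsRing) (V := C_NormedModule) f z.

(* Series over n >= 1 are indexed by k = n - 1, so that (-1)^(n-1) is
   (-1)^k. *)
Definition zeta_term (s : C) (k : nat) : C := Rcpow (INR (S k)) (Copp s).

Definition eta_term (s : C) (k : nat) : C :=
  Cmult (RtoC ((-1) ^ k)) (Rcpow (INR (S k)) (Copp s)).

Definition harmonic (n : nat) : R := sum_n_m (fun j => / INR j) 1 n.

Definition u_term (s : C) (k : nat) : C :=
  Cmult (eta_term s k) (RtoC (harmonic (S k))).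

(* [f] is entire and, on Re s > 0, the series with terms [a s k] converges
   with sum [f s]; the identity theorem gives at most one such [f]. *)
Definition is_entire_extension (a : C -> nat -> C) (f : C -> C) : Prop :=
  entire f /\
  forall s : C, 0 < Re s ->
    is_series (K := C_AbsRing) (V := C_NormedModule) (a s) (f s).

Definition is_riemann_zeta (zeta : C -> C) : Prop :=
  (forall s : C, s <> RtoC 1 ->
     ex_derive (K := C_AbsRing) (V := C_NormedModule) zeta s) /\
  (forall s : C, 1 < Re s ->
     is_series (K := C_AbsRing) (V := C_NormedModule) (zeta_term s) (zeta s)).

(* The relation to zeta has no content at s = 1, the pole of zeta; there the
   value of eta is the sum of its series. *)
Definition is_dirichlet_eta (eta : C -> C) : Prop :=
  is_entire_extension eta_term eta /\
  exists zeta : C -> C,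
    is_riemann_zeta zeta /\
    forall s : C, s <> RtoC 1 ->
      eta s =
      Cmult (Cminus (RtoC 1) (Rcpow 2 (Cminus (RtoC 1) s))) (zeta s).

(* [E n x] is the value at [x] of the n-th Euler polynomial. *)
Definition is_euler_polynomials (E : nat -> R -> R) : Prop :=
  forall x t : R, Rabs t < PI ->
    is_series (fun n => E n x * (t ^ n / INR (fact n)))
      (2 * exp (x * t) / (exp t + 1)).

(* The expansion is only required for t <> 0 near 0: at t = 0 the quotient is
   a removable singularity, where Rocq's total division does not give 1. *)
Definition is_bernoulli_numbers (B : nat -> R) : Prop :=
  locally' 0 (fun t : R =>
    is_series (fun n => B n * (t ^ n / INR (fact n))) (t / (exp t - 1))).

(* Main.v *)
(** Everything rests on the Euler-Boole identity.  Put [c m = E_m(0) / m!] and let [phi x = x^(-s)].  Since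
    [sum_i c (K - i) / i! = - c K] for [K >= 1], integrating by parts [K] times gives
      [2 phi(x) = sum_(m <= K) c m (phi^(m)(x) + phi^(m)(x + 1)) - R],
    where [R] is an integral over [[0, 1]] of [E_K(1 - t) / K!] against [phi^(K+1)(x + t)], hence
    [O(x^(-s-K-1))].  Multiplying by [(-1)^(k) a_k], [x = k + 1], and summing, the first part telescopes to a
    combination of values [G(s + m)] of an entire function ([G = 1] for [eta], where [a_k = 1];
    [G(s) = eta(s + 1)] for [u], where [a_k] is the harmonic number), and the remainder converges
    absolutely and is holomorphic for [Re s > 3 - K].  These half-plane continuations glue
    to an entire function; at [s = -n] the remainder carries the factor [s (s + 1) ... (s + K) = 0], so the
    value is a finite sum.  The result concerns every entire [u] extending the series, and likewise
    every admissible [eta], so the identity theorem is needed for functions that are merely complex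
    differentiable: it is derived from Goursat's theorem on rectangles. *)

(* The sum of the values at [x] and [x + 1] is what alternating signs make summable: summation by
   parts turns [sum (-1)^k a_k (phi(k+1) + phi(k+2))] into the series of [phi] with coefficients
   [a_k - a_(k-1)]. For [a_k = 1] only the first difference survives; for harmonic numbers the
   difference is [1/(k+1)], which raises the exponent by one. This is the origin of [G = 1] and
   [G(s) = eta(s + 1)]. The closed forms come from parity. At [s = -N] the [m]-th term carries
   [E_m(0) eta(1 - N + m)], where [E_m(0) = 0] for even [m >= 2] and [eta] vanishes at the negative
   even integers. For [N = 2n] these zeros cover complementary indices, and only [m = 0] and
   [m = 2n - 1] survive, the latter through [eta(0) = 1/2]. For [N = 2n - 1] they fall on the same
   indices, so all odd [m] remain. The thresholds 3 and 4 on exponents: the crude bound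
   [a_k <= k + 1] costs one power and [1/k^2] must be left for summability; the fourth power pays
   for the logarithms that differentiation in [s] produces. *)
Require Import Defs.
From Stdlib Require Import Reals Factorial Lra Lia ZArith.
From Coquelicot Require Import Coquelicot.
Open Scope R_scope.

(** * Complex differentiation and the exponential *)

(* The two normed modules carry different uniform structures on [C]; Coquelicot's product and chain rules
   are stated for [AbsRing_NormedModule] only. *)
Lemma is_derive_C_alt (f : C -> C) (z l : C) :
  is_derive (K := C_AbsRing) (V := C_NormedModule) f z l <->
  is_derive (K := C_AbsRing) (V := AbsRing_NormedModule C_AbsRing) f z l.
Proof.
  split; intros [[H1 H2 [M HM]] H]; split; try exact H.
  - split; [exact H1 | exact H2 | exists M; exact HM].
  - split; [exact H1 | exact H2 | exists M; exact HM].
Qed.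

Lemma is_derive_C_eps (f : C -> C) (z l : C) :
  is_derive (K := C_AbsRing) (V := AbsRing_NormedModule C_AbsRing) f z l <->
  forall eps : R, 0 < eps -> exists del : R, 0 < del /\
    forall w : C, Cmod (w - z) < del ->
      Cmod (f w - f z - (w - z) * l) <= eps * Cmod (w - z).
Proof.
  split.
  - intros [_ H] eps Heps.
    destruct (H z (fun P HP => HP) (mkposreal eps Heps)) as [d Hd].
    exists d; split; [apply cond_pos|].
    intros w Hw; exact (Hd w Hw).
  - intros H; split.
    + apply is_linear_scal_l.
    + intros y Hy.
      assert (Ey : z = y) by (apply (is_filter_lim_locally_unique _ _ Hy)).
      subst y.
      intros eps; destruct (H eps (cond_pos eps)) as [d [Hd H']].
      exists (mkposreal d Hd); intros w Hw; exact (H' w Hw).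
Qed.

Lemma Cmod_le_Rabs (z : C) : Cmod z <= Rabs (Re z) + Rabs (Im z).
Proof.
  destruct z as [x y]; unfold Cmod, Re, Im; simpl fst; simpl snd.
  apply Rsqr_incr_0_var.
  - rewrite Rsqr_sqrt by nra. unfold Rsqr.
    rewrite <- (pow2_abs x), <- (pow2_abs y).
    pose proof (Rabs_pos x); pose proof (Rabs_pos y); nra.
  - pose proof (Rabs_pos x); pose proof (Rabs_pos y); lra.
Qed.

Lemma im_le_Cmod (z : C) : Rabs (Im z) <= Cmod z.
Proof.
  eapply Rle_trans; [|apply Rmax_Cmod]. apply Rmax_r.
Qed.

Lemma C_ext (a b : C) : Re a = Re b -> Im a = Im b -> a = b.
Proof. destruct a, b; simpl; intros; subst; reflexivity. Qed.

Lemma Cexp_plus (a b : C) : Cexp (a + b) = (Cexp a * Cexp b)%C.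
Proof.
  destruct a as [x y], b as [u v]; unfold Cexp, Cmult, Cplus, Re, Im; simpl.
  rewrite exp_plus, cos_plus, sin_plus. f_equal; ring.
Qed.

Lemma Cexp_0 : Cexp 0 = 1.
Proof. unfold Cexp; simpl; rewrite exp_0, cos_0, sin_0. apply C_ext; simpl; ring. Qed.

Lemma Cmod_Cexp (z : C) : Cmod (Cexp z) = exp (Re z).
Proof.
  unfold Cmod, Cexp; simpl.
  replace (_ + _) with (Rsqr (exp (Re z)) * ((Rsqr (sin (Im z))) + Rsqr (cos (Im z)))) by (unfold Rsqr; ring).
  rewrite sin2_cos2, Rmult_1_r.
  apply sqrt_Rsqr, Rlt_le, exp_pos.
Qed.

Lemma exp_le (a b : R) : a <= b -> exp a <= exp b.
Proof. intros [H| ->]; [left; now apply exp_increasing | right; reflexivity]. Qed.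

(** Multiplying [1 - x <= exp (- x)] by [exp x] gives [exp x - 1 <= x * exp x]; the other side is
    [1 + x <= exp x]. *)
Lemma exp_sub1_bound (x : R) : Rabs (exp x - 1) <= Rabs x * exp (Rabs x).
Proof.
  pose proof (exp_ineq1_le x) as H1. pose proof (exp_ineq1_le (- x)) as H2.
  pose proof (exp_pos x) as H3.
  assert (H4 : exp x * exp (- x) = 1) by (rewrite <- exp_plus, Rplus_opp_r; apply exp_0).
  unfold Rabs; destruct (Rcase_abs x), (Rcase_abs (exp x - 1)); try nra.
Qed.

Lemma exp_sub1_lin_bound (x : R) : Rabs (exp x - 1 - x) <= x ^ 2 * exp (Rabs x).
Proof.
  pose proof (exp_ineq1_le x) as H1. pose proof (exp_ineq1_le (- x)) as H2.
  pose proof (exp_pos x) as H3. pose proof (exp_pos (- x)) as H5.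
  assert (H4 : exp x * exp (- x) = 1) by (rewrite <- exp_plus, Rplus_opp_r; apply exp_0).
  rewrite Rabs_pos_eq by lra.
  unfold Rabs; destruct (Rcase_abs x); nra.
Qed.

Lemma sin_abs_le (y : R) : Rabs (sin y) <= Rabs y.
Proof.
  destruct (Req_dec y 0) as [->|Hy]; [rewrite sin_0; lra|].
  destruct (MVT_abs sin cos 0 y) as [c [Hc _]].
  { intros c _; apply derivable_pt_lim_sin. }
  rewrite sin_0, !Rminus_0_r in Hc. rewrite Hc.
  pose proof (Rabs_pos y); pose proof (COS_bound c).
  assert (Rabs (cos c) <= 1) by (apply Rabs_le; lra). nra.
Qed.

Lemma cos_sub1_bound (y : R) : Rabs (cos y - 1) <= y ^ 2 / 2.
Proof.
  replace y with (2 * (y / 2)) by field. rewrite cos_2a_sin.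
  pose proof (sin_abs_le (y / 2)) as H.
  replace (1 - _ - 1) with (- (2 * sin (y/2) ^ 2)) by ring.
  rewrite Rabs_Ropp, Rabs_pos_eq by nra.
  rewrite <- (pow2_abs (sin (y/2))).
  replace ((2 * (y / 2)) ^ 2 / 2) with (2 * (y/2) ^ 2) by field.
  rewrite <- (pow2_abs (y / 2)). pose proof (Rabs_pos (sin (y/2))). nra.
Qed.

(** The mean value theorem gives the slope [cos c - 1 = - 2 sin^2 (c / 2)]. One factor of the square
    is at most [|c| / 2], the other at most 1, so the slope is at most [|y|]. *)
Lemma sin_sub_bound (y : R) : Rabs (sin y - y) <= y ^ 2.
Proof.
  destruct (Req_dec y 0) as [->|Hy]; [rewrite sin_0, Rminus_0_r, Rabs_R0; lra|].
  destruct (MVT_abs (fun y => sin y - y) (fun y => cos y - 1) 0 y) as [c [Hc Hb]].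
  { intros c _. apply is_derive_Reals. auto_derive; trivial; ring. }
  rewrite sin_0, !Rminus_0_r in Hc. rewrite Hc.
  assert (Hc2 : Rabs c <= Rabs y).
  { revert Hb. unfold Rmin, Rmax; destruct (Rle_dec 0 y); intros Hb.
    - rewrite !Rabs_pos_eq; lra.
    - rewrite !Rabs_left1; lra. }
  replace (cos c - 1) with (- (2 * sin (c/2) ^ 2)).
  2:{ replace c with (2 * (c/2)) at 2 by field. rewrite cos_2a_sin. ring. }
  rewrite Rabs_Ropp, Rabs_pos_eq by nra.
  pose proof (sin_abs_le (c/2)) as H1. pose proof (SIN_bound (c/2)) as H2.
  rewrite <- (pow2_abs (sin (c/2))), <- (pow2_abs y).
  assert (H3 : Rabs (sin (c/2)) <= 1) by (apply Rabs_le; lra).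
  assert (H4 : Rabs (c / 2) = Rabs c / 2).
  { unfold Rdiv; rewrite Rabs_mult, (Rabs_pos_eq (/2)) by lra; reflexivity. }
  pose proof (Rabs_pos (sin (c/2))). pose proof (Rabs_pos y).
  assert (H5 : 2 * Rabs (sin (c/2)) ^ 2 <= Rabs y) by nra.
  nra.
Qed.

(** Each component of the error splits into a real exponential error and a trigonometric one. The
    four pieces are each at most [m^2 exp m] with [m = |z|]; the constant 5 is not sharp. *)
Lemma Cexp_bound2 (z : C) :
  Cmod (Cexp z - 1 - z) <= 5 * (Cmod z) ^ 2 * exp (Cmod z).
Proof.
  destruct z as [x y]. set (m := Cmod (x, y)).
  assert (Hx : Rabs x <= m) by exact (re_le_Cmod (x, y)).
  assert (Hy : Rabs y <= m) by exact (im_le_Cmod (x, y)).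
  assert (He : exp (Rabs x) <= exp m) by now apply exp_le.
  assert (He' : exp x <= exp m).
  { apply exp_le. pose proof (Rle_abs x); lra. }
  pose proof (exp_pos x) as Hp. pose proof (Rabs_pos x). pose proof (Rabs_pos y).
  assert (H1m : 1 <= exp m) by (rewrite <- exp_0; apply exp_le; lra).
  eapply Rle_trans; [apply Cmod_le_Rabs|].
  unfold Cexp; simpl Re; simpl Im.
  replace (exp x * cos y + - (1) + - x) with ((exp x - 1 - x) + exp x * (cos y - 1)) by ring.
  replace (exp x * sin y + - 0 + - y) with (exp x * (sin y - y) + (exp x - 1) * y) by ring.
  pose proof (exp_sub1_lin_bound x) as B1. pose proof (cos_sub1_bound y) as B2.
  pose proof (sin_sub_bound y) as B3. pose proof (exp_sub1_bound x) as B4.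
  eapply Rle_trans. { apply Rplus_le_compat; apply Rabs_triang. }
  rewrite !Rabs_mult, (Rabs_pos_eq (exp x)) by lra.
  rewrite <- (pow2_abs x) in B1. rewrite <- (pow2_abs y) in B2, B3.
  set (a := Rabs x) in *. set (b := Rabs y) in *. set (e := exp m) in *.
  assert (0 <= m ^ 2) by nra. assert (a ^ 2 <= m ^ 2) by nra. assert (b ^ 2 <= m ^ 2) by nra.
  assert (T1 : Rabs (exp x - 1 - x) <= m ^ 2 * e).
  { eapply Rle_trans; [exact B1|]. apply Rmult_le_compat; try nra; left; apply exp_pos. }
  assert (T2 : exp x * Rabs (cos y - 1) <= e * m ^ 2).
  { apply Rmult_le_compat; try lra; try apply Rabs_pos. }
  assert (T3 : exp x * Rabs (sin y - y) <= e * m ^ 2).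
  { apply Rmult_le_compat; try lra; try apply Rabs_pos. }
  assert (T4 : Rabs (exp x - 1) * b <= m * e * m).
  { apply Rmult_le_compat; try lra; try apply Rabs_pos.
    eapply Rle_trans; [exact B4|]. apply Rmult_le_compat; try lra. left; apply exp_pos. }
  nra.
Qed.

Definition Cder (f : C -> C) (z l : C) : Prop :=
  is_derive (K := C_AbsRing) (V := AbsRing_NormedModule C_AbsRing) f z l.

Lemma Cder_quadratic (f : C -> C) (z l : C) (M d : R) :
  0 < d ->
  (forall w, Cmod (w - z) < d -> Cmod (f w - f z - (w - z) * l) <= M * Cmod (w - z) ^ 2) ->
  Cder f z l.
Proof.
  intros Hd H. apply is_derive_C_eps. intros eps Heps.
  (* [M] may be zero or negative, so it is raised to at least 1 before dividing by it. *)
  set (M' := Rmax M 1).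
  assert (HM' : 1 <= M') by apply Rmax_r.
  assert (HMM : M <= M') by apply Rmax_l.
  assert (Hd' : 0 < eps / M') by (apply Rdiv_lt_0_compat; lra).
  exists (Rmin d (eps / M')). split; [now apply Rmin_pos|].
  intros w Hw.
  assert (Hw1 : Cmod (w - z) < d) by (eapply Rlt_le_trans; [exact Hw|apply Rmin_l]).
  assert (Hw2 : Cmod (w - z) < eps / M') by (eapply Rlt_le_trans; [exact Hw|apply Rmin_r]).
  eapply Rle_trans; [now apply H|].
  pose proof (Cmod_ge_0 (w - z)) as Hp.
  assert (Hm : M' * Cmod (w - z) <= eps).
  { apply Rmult_lt_compat_l with (r := M') in Hw2; [|lra].
    replace (M' * (eps / M')) with eps in Hw2 by (field; lra). lra. }
  set (m := Cmod (w - z)) in *. nra.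
Qed.

Lemma Cder_exp (z : C) : Cder Cexp z (Cexp z).
Proof.
  apply Cder_quadratic with (M := Cmod (Cexp z) * (5 * exp 1)) (d := 1); [lra|].
  intros w Hw. set (h := (w - z)%C) in *.
  replace w with (z + h)%C by (unfold h; ring).
  rewrite Cexp_plus.
  replace (Cexp z * Cexp h - Cexp z - h * Cexp z)%C with (Cexp z * (Cexp h - 1 - h))%C by ring.
  rewrite Cmod_mult, Rmult_assoc. apply Rmult_le_compat_l; [apply Cmod_ge_0|].
  eapply Rle_trans; [apply Cexp_bound2|].
  assert (exp (Cmod h) <= exp 1) by (apply exp_le; lra).
  pose proof (Cmod_ge_0 h). pose proof (exp_pos (Cmod h)). nra.
Qed.

Lemma Cder_id (z : C) : Cder (fun w => w) z 1.
Proof. apply @is_derive_id. Qed.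

Lemma Cder_const (c z : C) : Cder (fun _ => c) z 0.
Proof. apply @is_derive_const. Qed.

Lemma Cder_plus (f g : C -> C) (z a b : C) :
  Cder f z a -> Cder g z b -> Cder (fun w => (f w + g w)%C) z (a + b)%C.
Proof. apply @is_derive_plus. Qed.

Lemma Cder_mult (f g : C -> C) (z a b : C) :
  Cder f z a -> Cder g z b -> Cder (fun w => (f w * g w)%C) z (a * g z + f z * b)%C.
Proof. intros Ha Hb. apply @is_derive_mult; trivial. intros; apply Cmult_comm. Qed.

Lemma Cder_comp (f g : C -> C) (z a b : C) :
  Cder f (g z) a -> Cder g z b -> Cder (fun w => f (g w)) z (b * a)%C.
Proof. intros Ha Hb. exact (@is_derive_comp C_AbsRing (AbsRing_NormedModule C_AbsRing) f g z a b Ha Hb). Qed.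

Lemma Cder_ext (f g : C -> C) (z l : C) :
  (forall w, f w = g w) -> Cder f z l -> Cder g z l.
Proof. exact (@is_derive_ext C_AbsRing (AbsRing_NormedModule C_AbsRing) f g z l). Qed.

(** The value of the derivative is read off the shape of the function, normally into an evar; where
    a value is written out, it has that shape, as in [(1 + 0) * g]. *)
Ltac cder :=
  lazymatch goal with
  | |- Cder (fun w => Cplus (@?f w) (@?g w)) _ _ =>
      refine (Cder_plus f g _ _ _ _ _); cder
  | |- Cder (fun w => Cmult (@?f w) (@?g w)) _ _ =>
      refine (Cder_mult f g _ _ _ _ _); cder
  | |- Cder (fun w => Cexp (@?g w)) _ _ =>
      refine (Cder_comp Cexp g _ _ _ (Cder_exp _) _); cder
  | |- Cder (fun w => w) _ _ => exact (Cder_id _)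
  | |- Cder (fun _ => ?c) _ _ => exact (Cder_const c _)
  | _ => try eassumption
  end.

Lemma Cder_cont (f : C -> C) (z l : C) : Cder f z l ->
  forall eps : R, 0 < eps -> exists del : R, 0 < del /\
    forall w : C, Cmod (w - z) < del -> Cmod (f w - f z) < eps.
Proof.
  intros H eps Heps.
  destruct (proj1 (is_derive_C_eps f z l) H 1 Rlt_0_1) as [d [Hd H1]].
  set (L := 1 + Cmod l).
  assert (HL : 1 <= L) by (unfold L; pose proof (Cmod_ge_0 l); lra).
  assert (Hd' : 0 < eps / L) by (apply Rdiv_lt_0_compat; lra).
  exists (Rmin d (eps / L)). split; [now apply Rmin_pos|].
  intros w Hw.
  assert (Hw1 : Cmod (w - z) < d) by (eapply Rlt_le_trans; [exact Hw|apply Rmin_l]).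
  assert (Hw2 : Cmod (w - z) < eps / L) by (eapply Rlt_le_trans; [exact Hw|apply Rmin_r]).
  replace (f w - f z)%C with ((f w - f z - (w - z) * l) + (w - z) * l)%C by ring.
  eapply Rle_lt_trans; [apply Cmod_triangle|].
  rewrite Cmod_mult. specialize (H1 w Hw1).
  apply Rmult_lt_compat_l with (r := L) in Hw2; [|lra].
  replace (L * (eps / L)) with eps in Hw2 by (field; lra). unfold L in Hw2. lra.
Qed.

(** * Integrals of complex-valued functions on real intervals *)

Definition CexInt (f : R -> C) (a b : R) : Prop :=
  ex_RInt (fun t => Re (f t)) a b /\ ex_RInt (fun t => Im (f t)) a b.

Definition CInt (f : R -> C) (a b : R) : C :=
  (RInt (fun t => Re (f t)) a b, RInt (fun t => Im (f t)) a b).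

Lemma CexInt_plus (f g : R -> C) (a b : R) :
  CexInt f a b -> CexInt g a b -> CexInt (fun t => (f t + g t)%C) a b.
Proof.
  intros [H1 H2] [H3 H4]; split.
  - exact (ex_RInt_plus _ _ a b H1 H3).
  - exact (ex_RInt_plus _ _ a b H2 H4).
Qed.

Lemma CInt_plus (f g : R -> C) (a b : R) :
  CexInt f a b -> CexInt g a b ->
  CInt (fun t => (f t + g t)%C) a b = (CInt f a b + CInt g a b)%C.
Proof.
  intros [H1 H2] [H3 H4]; apply C_ext.
  - exact (RInt_plus _ _ a b H1 H3).
  - exact (RInt_plus _ _ a b H2 H4).
Qed.

Lemma CInt_scal (k : C) (f : R -> C) (a b : R) :
  CexInt f a b ->
  CexInt (fun t => (k * f t)%C) a b /\
  CInt (fun t => (k * f t)%C) a b = (k * CInt f a b)%C.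
Proof.
  intros [H1 H2]. destruct k as [p q].
  pose proof (ex_RInt_scal _ a b p H1) as K1.
  pose proof (ex_RInt_scal _ a b q H2) as K2.
  pose proof (ex_RInt_scal _ a b p H2) as K3.
  pose proof (ex_RInt_scal _ a b q H1) as K4.
  split; [split|apply C_ext].
  - exact (ex_RInt_minus _ _ a b K1 K2).
  - exact (ex_RInt_plus _ _ a b K3 K4).
  - exact (eq_trans (RInt_minus _ _ a b K1 K2)
      (f_equal2 Rminus (RInt_scal _ a b p H1) (RInt_scal _ a b q H2))).
  - exact (eq_trans (RInt_plus _ _ a b K3 K4)
      (f_equal2 Rplus (RInt_scal _ a b p H2) (RInt_scal _ a b q H1))).
Qed.

Lemma CInt_ext (f g : R -> C) (a b : R) :
  (forall t, f t = g t) -> CInt f a b = CInt g a b.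
Proof.
  intros H; apply C_ext; apply RInt_ext; intros; now rewrite H.
Qed.

(* The factor 2 comes from bounding the two components separately. *)
Lemma CInt_bound (f : R -> C) (a b M : R) : a <= b -> CexInt f a b ->
  (forall t, a <= t <= b -> Cmod (f t) <= M) ->
  Cmod (CInt f a b) <= 2 * M * (b - a).
Proof.
  intros Hab [H1 H2] HM.
  eapply Rle_trans; [apply Cmod_le_Rabs|]. simpl Re; simpl Im.
  assert (A1 : Rabs (RInt (fun t => Re (f t)) a b) <= (b - a) * M).
  { apply abs_RInt_le_const; trivial. intros t Ht.
    eapply Rle_trans; [apply re_le_Cmod|now apply HM]. }
  assert (A2 : Rabs (RInt (fun t => Im (f t)) a b) <= (b - a) * M).
  { apply abs_RInt_le_const; trivial. intros t Ht.
    eapply Rle_trans; [apply im_le_Cmod|now apply HM]. }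
  lra.
Qed.

Lemma CInt_Chasles (f : R -> C) (a b c : R) :
  CexInt f a b -> CexInt f b c -> (CInt f a b + CInt f b c)%C = CInt f a c.
Proof.
  intros [H1 H2] [H3 H4]; apply C_ext.
  - exact (RInt_Chasles _ a b c H1 H3).
  - exact (RInt_Chasles _ a b c H2 H4).
Qed.

Lemma continuous_R_eps (f : R -> R) (x : R) :
  (forall eps, 0 < eps -> exists del, 0 < del /\
     forall y, Rabs (y - x) < del -> Rabs (f y - f x) < eps) ->
  continuous f x.
Proof.
  intros H P [eps HP]. destruct (H eps (cond_pos eps)) as [d [Hd Hd']].
  exists (mkposreal d Hd). intros y Hy. apply HP. exact (Hd' y Hy).
Qed.

Lemma CexInt_cont (f : R -> C) (a b : R) : a <= b ->
  (forall t, a <= t <= b -> forall eps, 0 < eps -> exists del, 0 < del /\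
     forall y, Rabs (y - t) < del -> Cmod (f y - f t) < eps) ->
  CexInt f a b.
Proof.
  intros Hab H; split; apply (ex_RInt_continuous (V := R_CompleteNormedModule));
    intros t Ht; rewrite Rmin_left, Rmax_right in Ht by lra;
    apply continuous_R_eps; intros eps Heps;
    destruct (H t Ht eps Heps) as [d [Hd Hd']]; exists d; split; trivial;
    intros y Hy; (eapply Rle_lt_trans; [|exact (Hd' y Hy)]).
  - exact (re_le_Cmod (f y - f t)).
  - exact (im_le_Cmod (f y - f t)).
Qed.

(** * Goursat's theorem on rectangles *)

Lemma CInt_FTC (F f : R -> C) (a b : R) : a <= b ->
  (forall t, a <= t <= b ->
     is_derive (fun t => Re (F t)) t (Re (f t)) /\
     is_derive (fun t => Im (F t)) t (Im (f t)) /\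
     continuous (fun t => Re (f t)) t /\ continuous (fun t => Im (f t)) t) ->
  CexInt f a b /\ CInt f a b = (F b - F a)%C.
Proof.
  intros Hab H.
  assert (H1 : is_RInt (fun t => Re (f t)) a b (Re (F b) - Re (F a))).
  { apply (is_RInt_derive (fun t => Re (F t)));
      intros t Ht; rewrite Rmin_left, Rmax_right in Ht by lra; apply H; trivial. }
  assert (H2 : is_RInt (fun t => Im (f t)) a b (Im (F b) - Im (F a))).
  { apply (is_RInt_derive (fun t => Im (F t)));
      intros t Ht; rewrite Rmin_left, Rmax_right in Ht by lra; apply H; trivial. }
  split; [split; eexists; eassumption|].
  apply C_ext; simpl; apply is_RInt_unique; assumption.
Qed.

Lemma nested_intervals (u v : nat -> R) :
  (forall n, u n <= u (S n)) -> (forall n, v (S n) <= v n) -> (forall n, u n <= v n) ->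
  exists p, forall n, u n <= p <= v n.
Proof.
  intros Hu Hv Huv.
  assert (Hu' : forall n m, u n <= u (n + m)%nat).
  { intros n m; induction m; [rewrite Nat.add_0_r; lra|].
    rewrite Nat.add_succ_r; eapply Rle_trans; [exact IHm|apply Hu]. }
  assert (Hv' : forall n m, v (n + m)%nat <= v n).
  { intros n m; induction m; [rewrite Nat.add_0_r; lra|].
    rewrite Nat.add_succ_r; eapply Rle_trans; [apply Hv|exact IHm]. }
  assert (Hb : forall n m, u n <= v m).
  { intros n m. apply Rle_trans with (u (n + m)%nat); [apply Hu'|].
    apply Rle_trans with (v (n + m)%nat); [apply Huv|]. rewrite Nat.add_comm. apply Hv'. }
  destruct (completeness (fun x => exists n, x = u n)) as [p [Hp1 Hp2]].
  - exists (v O). intros x [n ->]. apply Hb.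
  - exists (u O). now exists O.
  - exists p. intros n; split; [apply Hp1; now exists n|].
    apply Hp2. intros x [m ->]. apply Hb.
Qed.

(** The combinatorial core of Goursat's proof: [J x y l] stands for the modulus of the integral
    around the rectangle at [(x, y)] with sides [l * A] and [l * B]. If [J x y 1 = c > 0], some
    quarter keeps at least a quarter of [J]; iterating gives [J >= c * l^2] on nested rectangles,
    against the local bound [(c / 2) * l^2] at their common point. *)
Lemma bisection_nonpos (A B : R) (J : R -> R -> R -> R) :
  0 <= A -> 0 <= B ->
  (forall x y l, 0 < l -> J x y (2 * l) <=
     J x y l + J (x + l * A) y l + J x (y + l * B) l + J (x + l * A) (y + l * B) l) ->
  (forall p q eps, 0 < eps -> exists del, 0 < del /\ forall x y l,
     0 < l < del -> x <= p <= x + l * A -> y <= q <= y + l * B ->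
     J x y l <= eps * l ^ 2) ->
  forall x y, J x y 1 <= 0.
Proof.
  intros HA HB Hsub Hloc x y. apply Rnot_lt_le; intros Hc. set (c := J x y 1) in Hc.
  (* The last branch needs no test: if three quarters fall below a quarter of the total,
     subadditivity forces the fourth above it. *)
  set (step := fun (l : R) (p : R * R) =>
    let (x, y) := p in
    if Rle_dec (J x y (2 * l) / 4) (J x y l) then (x, y)
    else if Rle_dec (J x y (2 * l) / 4) (J (x + l * A) y l) then (x + l * A, y)
    else if Rle_dec (J x y (2 * l) / 4) (J x (y + l * B) l) then (x, y + l * B)
    else (x + l * A, y + l * B)).
  assert (Hstep : forall l x y, 0 < l ->
    let p := step l (x, y) in
    J x y (2 * l) / 4 <= J (fst p) (snd p) l /\
    x <= fst p /\ fst p + l * A <= x + 2 * l * A /\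
    y <= snd p /\ snd p + l * B <= y + 2 * l * B).
  { intros l x0 y0 Hl. specialize (Hsub x0 y0 l Hl). simpl. unfold step.
    assert (0 <= l * A) by nra. assert (0 <= l * B) by nra.
    destruct (Rle_dec _ _); simpl; [repeat split; lra|].
    destruct (Rle_dec _ _); simpl; [repeat split; lra|].
    destruct (Rle_dec _ _); simpl; [repeat split; lra|].
    repeat split; lra. }
  set (s := fix s (n : nat) : R * R :=
    match n with O => (x, y) | S k => step ((1/2) ^ (S k)) (s k) end).
  assert (Hl : forall n, 0 < (1/2) ^ n) by (intros; apply pow_lt; lra).
  assert (Hs : forall n,
    J (fst (s n)) (snd (s n)) ((1/2) ^ n) / 4 <= J (fst (s (S n))) (snd (s (S n))) ((1/2) ^ S n) /\
    fst (s n) <= fst (s (S n)) /\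
    fst (s (S n)) + (1/2) ^ S n * A <= fst (s n) + (1/2) ^ n * A /\
    snd (s n) <= snd (s (S n)) /\
    snd (s (S n)) + (1/2) ^ S n * B <= snd (s n) + (1/2) ^ n * B).
  { intros n. replace ((1/2) ^ n) with (2 * (1/2) ^ S n) by (simpl; field).
    change (s (S n)) with (step ((1/2) ^ S n) (s n)).
    destruct (s n) as [a b]. apply (Hstep ((1/2) ^ S n) a b). apply Hl. }
  assert (HJ : forall n, c * ((1/2) ^ n) ^ 2 <= J (fst (s n)) (snd (s n)) ((1/2) ^ n)).
  { induction n; [simpl; unfold c; lra|].
    destruct (Hs n) as [H _]. eapply Rle_trans; [|exact H].
    replace (((1/2) ^ S n) ^ 2) with (((1/2) ^ n) ^ 2 / 4) by (simpl; field). lra. }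
  destruct (nested_intervals (fun n => fst (s n)) (fun n => fst (s n) + (1/2) ^ n * A)) as [p Hp].
  { intros n; apply Hs. } { intros n; apply Hs. }
  { intros n. pose proof (Hl n). nra. }
  destruct (nested_intervals (fun n => snd (s n)) (fun n => snd (s n) + (1/2) ^ n * B)) as [q Hq].
  { intros n; apply Hs. } { intros n; apply Hs. }
  { intros n. pose proof (Hl n). nra. }
  destruct (Hloc p q (c / 2)) as [d [Hd H]]; [lra|].
  destruct (pow_lt_1_zero (1/2)) with (y := d) as [N HN]; [rewrite Rabs_pos_eq; lra|exact Hd|].
  specialize (HN N (le_n N)). rewrite Rabs_pos_eq in HN by (left; apply Hl).
  specialize (H (fst (s N)) (snd (s N)) ((1/2) ^ N) (conj (Hl N) HN) (Hp N) (Hq N)).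
  specialize (HJ N). pose proof (Hl N). assert (0 < ((1/2) ^ N) ^ 2) by (apply pow_lt; lra). nra.
Qed.

(** The contour integral over the boundary, counterclockwise; [Ci] is [dz / dt] on the vertical
    sides. *)
Definition rect_int (f : C -> C) (x y A B : R) : C :=
  (CInt (fun t => f (t, y)) x (x + A) + Ci * CInt (fun t => f ((x + A)%R, t)) y (y + B)
   - CInt (fun t => f (t, (y + B)%R)) x (x + A) - Ci * CInt (fun t => f (x, t)) y (y + B))%C.

Lemma Cmod_hor (a b y : R) : Cmod ((a, y) - (b, y)) = Rabs (a - b).
Proof.
  replace ((a, y) - (b, y))%C with (RtoC (a - b)) by (apply C_ext; simpl; ring).
  apply Cmod_R.
Qed.

Lemma Cmod_ver (a b x : R) : Cmod ((x, a) - (x, b)) = Rabs (a - b).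
Proof.
  replace ((x, a) - (x, b))%C with (Ci * RtoC (a - b))%C by (apply C_ext; simpl; ring).
  rewrite Cmod_mult, Cmod_Ci, Cmod_R. ring.
Qed.

Lemma CexInt_hor (f : C -> C) (y a b : R) : a <= b -> (forall z, exists l, Cder f z l) ->
  CexInt (fun t => f (t, y)) a b.
Proof.
  intros Hab Hf. apply CexInt_cont; trivial. intros t _ eps He.
  destruct (Hf (t, y)) as [l Hl]. destruct (Cder_cont _ _ _ Hl eps He) as [d [Hd H]].
  exists d; split; trivial. intros u Hu; apply H. now rewrite Cmod_hor.
Qed.

Lemma CexInt_ver (f : C -> C) (x a b : R) : a <= b -> (forall z, exists l, Cder f z l) ->
  CexInt (fun t => f (x, t)) a b.
Proof.
  intros Hab Hf. apply CexInt_cont; trivial. intros t _ eps He.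
  destruct (Hf (x, t)) as [l Hl]. destruct (Cder_cont _ _ _ Hl eps He) as [d [Hd H]].
  exists d; split; trivial. intros u Hu; apply H. now rewrite Cmod_ver.
Qed.

Lemma rect_int_plus (f g : C -> C) (x y A B : R) : 0 <= A -> 0 <= B ->
  (forall z, exists l, Cder f z l) -> (forall z, exists l, Cder g z l) ->
  rect_int (fun z => (f z + g z)%C) x y A B = (rect_int f x y A B + rect_int g x y A B)%C.
Proof.
  intros HA HB Hf Hg. unfold rect_int.
  assert (Hh : forall y, CInt (fun t => (f (t, y) + g (t, y))%C) x (x + A) =
    (CInt (fun t => f (t, y)) x (x + A) + CInt (fun t => g (t, y)) x (x + A))%C).
  { intros; apply CInt_plus; apply CexInt_hor; trivial; lra. }
  assert (Hv : forall x, CInt (fun t => (f (x, t) + g (x, t))%C) y (y + B) =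
    (CInt (fun t => f (x, t)) y (y + B) + CInt (fun t => g (x, t)) y (y + B))%C).
  { intros; apply CInt_plus; apply CexInt_ver; trivial; lra. }
  rewrite (Hh y), (Hh (y + B)), (Hv x), (Hv (x + A)). ring.
Qed.

(** Each side is integrated by an explicit primitive of the restriction to that side; adding the
    four increments is then algebra. *)
Lemma rect_int_affine (a l : C) (x y A B : R) : 0 <= A -> 0 <= B ->
  rect_int (fun z => (a + l * z)%C) x y A B = 0.
Proof.
  intros HA HB. destruct a as [a1 a2], l as [l1 l2].
  assert (Hh : forall y x1 x2, x1 <= x2 ->
    CInt (fun t => ((a1, a2) + (l1, l2) * (t, y))%C) x1 x2 =
    (((a1, a2) * RtoC x2 + (l1, l2) * ((x2 ^ 2 / 2)%R, (y * x2)%R)) -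
     ((a1, a2) * RtoC x1 + (l1, l2) * ((x1 ^ 2 / 2)%R, (y * x1)%R)))%C).
  { intros y0 x1 x2 H.
    apply (CInt_FTC (fun t => ((a1, a2) * RtoC t + (l1, l2) * ((t ^ 2 / 2)%R, (y0 * t)%R))%C)); trivial.
    intros t _. simpl. refine (conj _ (conj _ (conj _ _))).
    - auto_derive; trivial; field.
    - auto_derive; trivial; field.
    - apply (ex_derive_continuous (K := R_AbsRing) (V := R_NormedModule)). auto_derive; trivial.
    - apply (ex_derive_continuous (K := R_AbsRing) (V := R_NormedModule)). auto_derive; trivial. }
  assert (Hv : forall x y1 y2, y1 <= y2 ->
    CInt (fun t => ((a1, a2) + (l1, l2) * (x, t))%C) y1 y2 =
    (((a1, a2) * RtoC y2 + (l1, l2) * ((x * y2)%R, (y2 ^ 2 / 2)%R)) -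
     ((a1, a2) * RtoC y1 + (l1, l2) * ((x * y1)%R, (y1 ^ 2 / 2)%R)))%C).
  { intros x0 y1 y2 H.
    apply (CInt_FTC (fun t => ((a1, a2) * RtoC t + (l1, l2) * ((x0 * t)%R, (t ^ 2 / 2)%R))%C)); trivial.
    intros t _. simpl. refine (conj _ (conj _ (conj _ _))).
    - auto_derive; trivial; field.
    - auto_derive; trivial; field.
    - apply (ex_derive_continuous (K := R_AbsRing) (V := R_NormedModule)). auto_derive; trivial.
    - apply (ex_derive_continuous (K := R_AbsRing) (V := R_NormedModule)). auto_derive; trivial. }
  unfold rect_int. rewrite !Hh, !Hv by lra. apply C_ext; simpl; field.
Qed.

(** The 4 is two parallel sides times the factor 2 of [CInt_bound]. *)
Lemma rect_int_bound (f : C -> C) (x y A B M : R) : 0 <= A -> 0 <= B ->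
  (forall z, exists l, Cder f z l) ->
  (forall u v, x <= u <= x + A -> y <= v <= y + B -> Cmod (f (u, v)) <= M) ->
  Cmod (rect_int f x y A B) <= 4 * M * (A + B).
Proof.
  intros HA HB Hf HM. unfold rect_int.
  assert (H1 : Cmod (CInt (fun t => f (t, y)) x (x + A)) <= 2 * M * (x + A - x)).
  { apply CInt_bound; [lra|apply CexInt_hor; trivial; lra|]. intros; apply HM; lra. }
  assert (H2 : Cmod (CInt (fun t => f (t, y + B)) x (x + A)) <= 2 * M * (x + A - x)).
  { apply CInt_bound; [lra|apply CexInt_hor; trivial; lra|]. intros; apply HM; lra. }
  assert (H3 : Cmod (CInt (fun t => f (x + A, t)) y (y + B)) <= 2 * M * (y + B - y)).
  { apply CInt_bound; [lra|apply CexInt_ver; trivial; lra|]. intros; apply HM; lra. }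
  assert (H4 : Cmod (CInt (fun t => f (x, t)) y (y + B)) <= 2 * M * (y + B - y)).
  { apply CInt_bound; [lra|apply CexInt_ver; trivial; lra|]. intros; apply HM; lra. }
  unfold Cminus.
  eapply Rle_trans; [apply Cmod_triangle|]. rewrite Cmod_opp, Cmod_mult, Cmod_Ci.
  eapply Rle_trans. { apply Rplus_le_compat_r, Cmod_triangle. } rewrite Cmod_opp.
  eapply Rle_trans. { do 2 apply Rplus_le_compat_r; apply Cmod_triangle. }
  rewrite Cmod_mult, Cmod_Ci. lra.
Qed.

(** Each inner edge is traversed twice in opposite directions and cancels. Separate [a2], [b2] let
    the doubled lengths appear in whatever form the goal has. *)
Lemma rect_int_quarter (f : C -> C) (x y a b a2 b2 : R) : 0 <= a -> 0 <= b ->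
  (forall z, exists l, Cder f z l) -> a2 = a + a -> b2 = b + b ->
  rect_int f x y a2 b2 = (rect_int f x y a b + rect_int f (x + a) y a b
    + rect_int f x (y + b) a b + rect_int f (x + a) (y + b) a b)%C.
Proof.
  intros Ha Hb Hf -> ->. unfold rect_int. rewrite <- !Rplus_assoc.
  assert (Hx1 : x <= x + a) by lra. assert (Hx2 : x + a <= x + a + a) by lra.
  assert (Hy1 : y <= y + b) by lra. assert (Hy2 : y + b <= y + b + b) by lra.
  (* With the corner coordinates as variables, [ring] sees each side integral as one atom. *)
  generalize dependent (y + b + b). generalize dependent (x + a + a).
  generalize dependent (x + a). generalize dependent (y + b).
  intros y1 Hy1 x1 Hx1 x2 Hx2 y2 Hy2.
  pose proof (fun y => CInt_Chasles (fun t => f (t, y)) x x1 x2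
    (CexInt_hor f y x x1 Hx1 Hf) (CexInt_hor f y x1 x2 Hx2 Hf)) as Hh.
  pose proof (fun x => CInt_Chasles (fun t => f (x, t)) y y1 y2
    (CexInt_ver f x y y1 Hy1 Hf) (CexInt_ver f x y1 y2 Hy2 Hf)) as Hv.
  simpl in Hh, Hv.
  rewrite <- (Hh y), <- (Hh y2), <- (Hv x), <- (Hv x2). ring.
Qed.

(** Near a point [f] is affine up to [o(|z - p|)], and the affine part integrates to zero. On a
    rectangle of scale [r] the error is [o(r)] and the perimeter [O(r)], which yields the [o(r^2)]
    that bisection contradicts. *)
Theorem goursat (f : C -> C) (x y A B : R) : 0 <= A -> 0 <= B ->
  (forall z, exists l, Cder f z l) -> rect_int f x y A B = 0.
Proof.
  intros HA HB Hf. apply Cmod_eq_0. apply Rle_antisym; [|apply Cmod_ge_0].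
  rewrite <- (Rmult_1_l A), <- (Rmult_1_l B).
  apply (bisection_nonpos A B (fun x y l => Cmod (rect_int f x y (l * A) (l * B)))); trivial.
  - intros x0 y0 l Hl. assert (0 <= l * A) by nra. assert (0 <= l * B) by nra.
    set (a := l * A) in *. set (b := l * B) in *.
    rewrite (rect_int_quarter f x0 y0 a b _ _) by (trivial; unfold a, b; ring).
    eapply Rle_trans; [apply Cmod_triangle|]. apply Rplus_le_compat_r.
    eapply Rle_trans; [apply Cmod_triangle|]. apply Rplus_le_compat_r.
    apply Cmod_triangle.
  - intros p q eps Heps. destruct (Hf (p, q)) as [l Hl].
    set (S := 1 + A + B).
    assert (HS : 1 <= S) by (unfold S; lra).
    (* Chosen so that [rect_int_bound] with error [e * (r * S)] and half-perimeter at most [r * S]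
       gives exactly [eps * r^2]; the 1 in [S] keeps it positive for degenerate rectangles. *)
    set (e := eps / (4 * S ^ 2)).
    assert (He : 0 < e) by (apply Rdiv_lt_0_compat; nra).
    destruct (proj1 (is_derive_C_eps f (p, q) l) Hl e He) as [d [Hd H]].
    assert (Hd' : 0 < d / S) by (apply Rdiv_lt_0_compat; lra).
    exists (d / S). split; [trivial|]. intros x0 y0 r Hr Hp Hq.
    assert (0 <= r * A) by nra. assert (0 <= r * B) by nra.
    set (a := (f (p, q) - (p, q) * l)%C).
    set (g := fun z => (f z + (- a + - l * z))%C).
    assert (Haff : forall a l z, exists m, Cder (fun z => (a + l * z)%C) z m).
    { intros a' l' z. eexists. apply Cder_plus; [apply Cder_const|].
      apply Cder_mult; [apply Cder_const|apply Cder_id]. }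
    assert (Hg : forall z, exists m, Cder g z m).
    { intros z. destruct (Hf z) as [m Hm]. destruct (Haff (- a)%C (- l)%C z) as [m' Hm'].
      exists (m + m')%C. apply Cder_plus; trivial. }
    assert (E : rect_int f x0 y0 (r * A) (r * B) = rect_int g x0 y0 (r * A) (r * B)).
    { unfold g. rewrite rect_int_plus; trivial. rewrite rect_int_affine; trivial. ring. }
    rewrite E.
    eapply Rle_trans.
    { apply (rect_int_bound g x0 y0 (r * A) (r * B) (e * (r * S))); trivial.
      intros u v Hu Hv. unfold g, a.
      replace (f (u, v) + (- (f (p, q) - (p, q) * l) + - l * (u, v)))%C
        with (f (u, v) - f (p, q) - ((u, v) - (p, q)) * l)%C by ring.
      assert (Hdist : Cmod ((u, v) - (p, q)) <= r * (A + B)).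
      { eapply Rle_trans; [apply Cmod_le_Rabs|]. simpl.
        rewrite Rmult_plus_distr_l. apply Rplus_le_compat; apply Rabs_le; lra. }
      assert (r * (A + B) < r * S) by (unfold S; lra).
      assert (r * S < d).
      { destruct Hr as [_ Hr]. apply Rmult_lt_compat_r with (r := S) in Hr; [|lra].
        replace (d / S * S) with d in Hr by (field; lra). exact Hr. }
      eapply Rle_trans; [apply H; lra|].
      apply Rmult_le_compat_l; lra. }
    replace (eps * r ^ 2) with (4 * (e * (r * S)) * (r * S)) by (unfold e; field; lra).
    rewrite <- Rmult_plus_distr_l. apply Rmult_le_compat_l; [|unfold S; nra].
    assert (0 <= e * (r * S)) by (apply Rmult_le_pos; nra). lra.
Qed.

(** * The identity theorem for entire functions *)

Lemma entire_Cder (f : C -> C) : entire f <-> forall z, exists l, Cder f z l.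
Proof.
  split; intros H z; destruct (H z) as [l Hl]; exists l; apply is_derive_C_alt; exact Hl.
Qed.

Lemma exp_decay (M eps : R) : 0 < eps -> 0 <= M ->
  exists N : R, 0 < N /\ M * exp (- (N / 10)) < eps.
Proof.
  intros He HM. exists (10 * (M / eps + 1)).
  assert (0 <= M / eps).
  { apply Rmult_le_pos; [lra|]. left; now apply Rinv_0_lt_compat. }
  split; [lra|].
  replace (10 * (M / eps + 1) / 10) with (M / eps + 1) by (field; lra).
  rewrite exp_Ropp. pose proof (exp_ineq1_le (M / eps + 1)) as H1.
  assert (H2 : 0 < exp (M / eps + 1)) by apply exp_pos.
  apply (Rmult_lt_reg_r (exp (M / eps + 1))); trivial.
  rewrite Rmult_assoc, Rinv_l, Rmult_1_r by lra.
  apply Rlt_le_trans with (eps * (M / eps + 2)).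
  - replace (eps * (M / eps + 2)) with (M + 2 * eps) by (field; lra). lra.
  - apply Rmult_le_compat_l; lra.
Qed.

Lemma vertical_bounded (g : C -> C) (x a b : R) : a <= b ->
  (forall z, exists l, Cder g z l) ->
  exists M, 0 <= M /\ forall y, a <= y <= b -> Cmod (g (x, y)) <= M.
Proof.
  intros Hab Hg.
  destruct (continuity_ab_maj (fun y => Cmod (g (x, y))) a b Hab) as [m [Hm _]].
  - intros c _. apply continuity_pt_filterlim. apply continuous_R_eps. intros eps He.
    destruct (Hg (x, c)) as [l Hl]. destruct (Cder_cont _ _ _ Hl eps He) as [d [Hd H]].
    exists d; split; trivial. intros y Hy.
    eapply Rle_lt_trans; [|apply (H (x, y)); now rewrite Cmod_ver].
    assert (T : forall u v, Cmod u - Cmod v <= Cmod (u - v)).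
    { intros u v. pose proof (Cmod_triangle (u - v) v) as T.
      replace (u - v + v)%C with u in T by ring. lra. }
    apply Rabs_le; split; [|apply T].
    pose proof (T (g (x, c)) (g (x, y))).
    replace (g (x, y) - g (x, c))%C with (- (g (x, c) - g (x, y)))%C by ring.
    rewrite Cmod_opp. lra.
  - exists (Cmod (g (x, m))). split; [apply Cmod_ge_0|exact Hm].
Qed.

(* The function [h (p + e^w) exp (N (z / r + z^2 / (2 r^2)))], with [z = e^w], is entire in [w] and
   [2 i PI]-periodic, so its mean over a circle [|z| = e^x] does not depend on [x]; it tends to [h p] as
   [x -> -oo].  On [|z| = r] the exponential has modulus [exp (N (cos y + cos (2 y) / 2))], at most
   [exp (- N / 10)] wherever [cos y <= 3/10]. *)
Lemma identity_aux (h : C -> C) (p : C) (r M N eps : R) :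
  (forall z, exists l, Cder h z l) ->
  0 < r -> 0 < eps -> 0 < N ->
  (forall y, 0 <= y <= 2 * PI -> 3 / 10 < cos y -> h (p + Cexp (ln r, y))%C = 0) ->
  (forall y, 0 <= y <= 2 * PI -> Cmod (h (p + Cexp (ln r, y))%C) <= M) ->
  0 <= M ->
  Cmod (h p) <= 2 * (eps + M * exp (- (N / 10))).
Proof.
  intros Hh Hr Heps HN Hz HM HM0.
  set (q := fun z => (RtoC (N / r) * z + RtoC (N / (2 * r ^ 2)) * (z * z))%C).
  set (K := fun z => (h (p + z) * Cexp (q z))%C).
  assert (Hq : forall z, exists l, Cder q z l).
  { intros z; eexists. unfold q. cder. }
  assert (HK : forall z, exists l, Cder K z l).
  { intros z. destruct (Hq z) as [lq Hlq]. destruct (Hh (p + z)%C) as [lh Hlh].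
    eexists. refine (Cder_mult (fun z => h (p + z)%C) (fun z => Cexp (q z)) _ _ _ _ _).
    - refine (Cder_comp h (fun z => (p + z)%C) _ _ _ Hlh _). cder.
    - exact (Cder_comp Cexp q _ _ _ (Cder_exp _) Hlq). }
  set (G := fun w => K (Cexp w)).
  assert (HG : forall z, exists l, Cder G z l).
  { intros z. destruct (HK (Cexp z)) as [l Hl]. eexists.
    exact (Cder_comp K Cexp _ _ _ Hl (Cder_exp _)). }
  assert (K0 : K 0 = h p).
  { unfold K, q. replace (p + 0)%C with p by ring.
    replace (RtoC (N / r) * 0 + RtoC (N / (2 * r ^ 2)) * (0 * 0))%C with (RtoC 0) by ring.
    rewrite Cexp_0. ring. }
  destruct (HK 0) as [l0 Hl0]. destruct (Cder_cont _ _ _ Hl0 eps Heps) as [d [Hd Hc]].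
  (* A circle small enough that [K] is within [eps] of [K 0 = h p] on it. *)
  set (x0 := Rmin (ln r) (ln (d / 2))).
  assert (Hx1 : x0 <= ln r) by apply Rmin_l.
  assert (Hx2 : exp x0 < d).
  { apply Rle_lt_trans with (d / 2); [|lra].
    rewrite <- (exp_ln (d / 2)) by lra. apply exp_le, Rmin_r. }
  pose proof PI_RGT_0 as HPI.
  (* Goursat on [[x0, ln r] x [0, 2 PI]]: the horizontal sides cancel by periodicity, leaving the
     two vertical ones, which are the two circles. *)
  assert (E : CInt (fun t => G (ln r, t)) 0 (2 * PI) = CInt (fun t => G (x0, t)) 0 (2 * PI)).
  { pose proof (goursat G x0 0 (ln r - x0) (2 * PI) ltac:(lra) ltac:(lra) HG) as E.
    unfold rect_int in E. rewrite !Rplus_0_l in E.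
    replace (x0 + (ln r - x0)) with (ln r) in E by ring.
    rewrite (CInt_ext (fun t => G (t, 2 * PI)) (fun t => G (t, 0))) in E.
    2:{ intros t. unfold G. f_equal. unfold Cexp; simpl.
        now rewrite cos_2PI, sin_2PI, cos_0, sin_0. }
    assert (E2 : (Ci * (CInt (fun t => G (ln r, t)) 0 (2 * PI) - CInt (fun t => G (x0, t)) 0 (2 * PI)) = 0)%C).
    { rewrite <- E. ring. }
    set (D := (CInt (fun t => G (ln r, t)) 0 (2 * PI) - CInt (fun t => G (x0, t)) 0 (2 * PI))%C) in *.
    assert (E3 : D = 0).
    { replace D with (- Ci * (Ci * D))%C by (apply C_ext; simpl; ring). rewrite E2. ring. }
    unfold D in E3. set (u := CInt _ _ _) in E3 |- *. set (v := CInt _ _ _) in E3 |- *.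
    replace u with (u - v + v)%C by ring. rewrite E3. ring. }
  assert (B1 : Cmod (CInt (fun t => G (ln r, t)) 0 (2 * PI)) <= 2 * (M * exp (- (N / 10))) * (2 * PI - 0)).
  { apply CInt_bound; [lra|apply CexInt_ver; trivial; lra|]. intros y Hy.
    unfold G, K. rewrite Cmod_mult.
    destruct (Rlt_le_dec (3 / 10) (cos y)) as [Hcos|Hcos].
    - rewrite Hz by trivial. rewrite Cmod_0, Rmult_0_l.
      apply Rmult_le_pos; [lra|left; apply exp_pos].
    - apply Rmult_le_compat; try apply Cmod_ge_0; [now apply HM|].
      rewrite Cmod_Cexp. apply exp_le. unfold q, Cexp. simpl.
      rewrite exp_ln by trivial.
      match goal with |- ?L <= _ =>
        replace L with (N * (cos y + (cos y * cos y - sin y * sin y) / 2)) by (field; lra) end.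
      pose proof (sin2_cos2 y) as S2. unfold Rsqr in S2. pose proof (COS_bound y) as Cb.
      replace (sin y * sin y) with (1 - cos y * cos y) by lra.
      set (c := cos y) in *.
      (* This is [c^2 + c - 1/2], convex in [c]: it is -1/2 at [c = -1] and -0.11 at [c = 3/10]. *)
      assert (c + (c * c - (1 - c * c)) / 2 <= - (1/10)) by nra. nra. }
  assert (B2 : Cmod (CInt (fun t => (G (x0, t) + - h p)%C) 0 (2 * PI)) <= 2 * eps * (2 * PI - 0)).
  { apply CInt_bound; [lra| |].
    - apply (CexInt_ver (fun z => (G z + - h p)%C)); [lra|]. intros z.
      destruct (HG z) as [l Hl]. eexists. cder.
    - intros t Ht. left. rewrite <- K0. apply Hc.
      replace (Cexp (x0, t) - 0)%C with (Cexp (x0, t)) by ring. now rewrite Cmod_Cexp. }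
  destruct (CInt_FTC (fun t => (RtoC t * - h p)%C) (fun _ => (- h p)%C) 0 (2 * PI)) as [X1 X2]; [lra| |].
  { intros t _. destruct (h p) as [a b]; simpl. refine (conj _ (conj _ (conj _ _))).
    - auto_derive; trivial; ring.
    - auto_derive; trivial; ring.
    - apply continuous_const.
    - apply continuous_const. }
  rewrite CInt_plus, X2, <- E in B2; trivial.
  2:{ apply CexInt_ver; trivial; lra. }
  set (I := CInt _ _ _) in *.
  (* [2 PI h(p)] is the integral over the large circle minus the deviation on the small one; [B1]
     and [B2] bound the two. *)
  assert (T : 2 * PI * Cmod (h p) <= Cmod I + Cmod (I + (RtoC (2 * PI) * - h p - 0 * - h p))).
  { replace (2 * PI * Cmod (h p)) with (Cmod (I + - (I + (RtoC (2 * PI) * - h p - 0 * - h p)))).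
    - eapply Rle_trans; [apply Cmod_triangle|]. rewrite Cmod_opp. lra.
    - replace (I + - (I + (RtoC (2 * PI) * - h p - 0 * - h p)))%C with (RtoC (2 * PI) * h p)%C by ring.
      rewrite Cmod_mult, Cmod_R, Rabs_pos_eq; lra. }
  apply (Rmult_le_reg_l (2 * PI)); lra.
Qed.

Theorem entire_zero (h : C -> C) : entire h ->
  (forall s, 0 < Re s -> h s = 0) -> forall p, h p = 0.
Proof.
  intros Hh Hz p. pose proof (proj1 (entire_Cder _) Hh) as Hh'.
  (* Then [cos y > 3/10] gives [Re p + r cos y > Re p + 1.2 |Re p| >= 0], so that arc lies in the
     half-plane where [h] vanishes. *)
  set (r := 4 * Rabs (Re p) + 1). pose proof (Rabs_pos (Re p)) as Hp.
  assert (Hr : 0 < r) by (unfold r; lra).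
  pose proof PI_RGT_0 as HPI.
  destruct (vertical_bounded (fun w => h (p + Cexp w)%C) (ln r) 0 (2 * PI)) as [M [HM0 HM]]; [lra| |].
  { intros z. destruct (Hh' (p + Cexp z)%C) as [l Hl]. eexists.
    refine (Cder_comp h (fun w => (p + Cexp w)%C) _ _ _ Hl _). cder. }
  apply Cmod_eq_0, Rle_antisym; [|apply Cmod_ge_0].
  apply Rnot_lt_le; intros Hc.
  (* Both error terms are at most [e], so the bound becomes half of [|h p|]. *)
  set (e := Cmod (h p) / 8). assert (He : 0 < e) by (unfold e; lra).
  destruct (exp_decay M e He HM0) as [N [HN HNe]].
  assert (H : Cmod (h p) <= 2 * (e + M * exp (- (N / 10)))).
  { apply (identity_aux h p r M N e); trivial.
    intros y _ Hy. apply Hz. unfold Cexp; simpl. rewrite exp_ln by trivial.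
    pose proof (Rle_abs (- Re p)) as Ha. rewrite Rabs_Ropp in Ha. unfold Re in *. unfold r. nra. }
  unfold e in *. lra.
Qed.

Lemma entire_unique (f g : C -> C) : entire f -> entire g ->
  (forall s, 0 < Re s -> f s = g s) -> forall p, f p = g p.
Proof.
  intros Hf Hg H p.
  (* The difference is spelled as a sum and a product, the shapes that [cder] handles. *)
  assert (E : (f p + - 1 * g p)%C = 0).
  { apply (entire_zero (fun z => (f z + - 1 * g z)%C)).
    - apply (proj2 (entire_Cder _)).
      pose proof (proj1 (entire_Cder _) Hf) as Hf'. pose proof (proj1 (entire_Cder _) Hg) as Hg'.
      intros z.
      destruct (Hf' z) as [a Ha], (Hg' z) as [b Hb]. eexists.
      cder.
    - intros s Hs. rewrite (H s Hs). ring. }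
  replace (f p) with (f p + - 1 * g p + g p)%C by ring. rewrite E. ring.
Qed.

(** * Complex series *)

Definition Cser (a : nat -> C) (l : C) : Prop :=
  is_series (K := C_AbsRing) (V := C_NormedModule) a l.

Lemma Cser_eps (a : nat -> C) (l : C) :
  Cser a l <-> forall eps, 0 < eps -> exists N, forall n, (N <= n)%nat ->
    Cmod (sum_n (G := C_AbelianMonoid) a n - l) < eps.
Proof.
  split.
  - intros H eps He.
    exact (proj1 (filterlim_locally_ball_norm (U := C_NormedModule) (F := eventually) _ l) H (mkposreal eps He)).
  - intros H. apply (filterlim_locally_ball_norm (U := C_NormedModule) (F := eventually)).
    intros eps. exact (H eps (cond_pos eps)).
Qed.

Lemma Cser_ext (a b : nat -> C) (l : C) : (forall n, a n = b n) -> Cser a l -> Cser b l.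
Proof. apply is_series_ext. Qed.

Lemma Cser_plus (a b : nat -> C) (la lb : C) :
  Cser a la -> Cser b lb -> Cser (fun n => (a n + b n)%C) (la + lb)%C.
Proof. apply @is_series_plus. Qed.

Lemma Cser_scal (c : C) (a : nat -> C) (l : C) :
  Cser a l -> Cser (fun n => (c * a n)%C) (c * l)%C.
Proof. apply (@is_series_scal C_AbsRing C_NormedModule). Qed.

Lemma Cser_unique (a : nat -> C) (l l' : C) : Cser a l -> Cser a l' -> l = l'.
Proof. intros H H'. exact (filterlim_locally_unique (V := C_NormedModule) (F := eventually) _ _ _ H H'). Qed.

Lemma sum_n_pair (a : nat -> C) (n : nat) :
  sum_n (G := C_AbelianMonoid) a n =
  (sum_n (fun k => Re (a k)) n, sum_n (fun k => Im (a k)) n).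
Proof.
  induction n.
  - rewrite !sum_O. now destruct (a O).
  - rewrite !sum_Sn, IHn. now destruct (a (S n)).
Qed.

Lemma Cser_pair (a : nat -> C) (x y : R) :
  is_series (fun k => Re (a k)) x -> is_series (fun k => Im (a k)) y -> Cser a (x, y).
Proof.
  intros Hx Hy. apply Cser_eps. intros eps He.
  destruct (proj1 (filterlim_locally _ _) Hx (mkposreal (eps / 2) ltac:(lra))) as [N1 H1].
  destruct (proj1 (filterlim_locally _ _) Hy (mkposreal (eps / 2) ltac:(lra))) as [N2 H2].
  exists (max N1 N2). intros n Hn.
  specialize (H1 n ltac:(lia)). specialize (H2 n ltac:(lia)).
  eapply Rle_lt_trans; [apply Cmod_le_Rabs|]. rewrite sum_n_pair. simpl.
  change (Rabs (sum_n (fun k => Re (a k)) n - x) < eps / 2) in H1.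
  change (Rabs (sum_n (fun k => Im (a k)) n - y) < eps / 2) in H2.
  unfold Rminus in H1, H2. lra.
Qed.

Definition CSeries (a : nat -> C) : C :=
  (Series (fun k => Re (a k)), Series (fun k => Im (a k))).

Lemma CSeries_correct (a : nat -> C) (b : nat -> R) :
  (forall n, Cmod (a n) <= b n) -> ex_series b -> Cser a (CSeries a).
Proof.
  intros H Hb. apply Cser_pair; apply Series_correct;
    apply (ex_series_le (V := R_CompleteNormedModule) _ b); trivial; intros n.
  - eapply Rle_trans; [apply re_le_Cmod|apply H].
  - eapply Rle_trans; [apply im_le_Cmod|apply H].
Qed.

Lemma Cser_bound (a : nat -> C) (b : nat -> R) (l : C) :
  (forall n, Cmod (a n) <= b n) -> ex_series b -> Cser a l -> Cmod l <= 2 * Series b.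
Proof.
  intros H Hb Hl. rewrite (Cser_unique a _ _ Hl (CSeries_correct a b H Hb)).
  eapply Rle_trans; [apply Cmod_le_Rabs|]. unfold CSeries; simpl.
  assert (T : forall f : nat -> R, (forall n, Rabs (f n) <= b n) -> Rabs (Series f) <= Series b).
  { intros f Hf.
    eapply Rle_trans; [apply Series_Rabs|].
    - apply (ex_series_le (V := R_CompleteNormedModule) _ b); trivial. intros n.
      change (Rabs (Rabs (f n)) <= b n). now rewrite Rabs_Rabsolu.
    - apply Series_le; trivial. intros n; split; [apply Rabs_pos|apply Hf]. }
  pose proof (T (fun k => Re (a k)) (fun n => Rle_trans _ _ _ (re_le_Cmod _) (H n))).
  pose proof (T (fun k => Im (a k)) (fun n => Rle_trans _ _ _ (im_le_Cmod _) (H n))).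
  lra.
Qed.

(** Termwise differentiation without uniform convergence of derivatives: a summable quadratic
    remainder adds up to a quadratic remainder. A single majorant [M] serves the values, the
    derivatives and the remainders. *)
Lemma Cder_series (F : nat -> C -> C) (D : nat -> C) (M : nat -> R) (z : C) (d : R) :
  0 < d -> ex_series M -> (forall n, Cmod (D n) <= M n) ->
  (forall w n, Cmod (w - z) < d -> Cmod (F n w) <= M n) ->
  (forall w n, Cmod (w - z) < d ->
     Cmod (F n w - F n z - (w - z) * D n) <= M n * Cmod (w - z) ^ 2) ->
  Cder (fun w => CSeries (fun n => F n w)) z (CSeries D).
Proof.
  intros Hd HM HD HF HQ.
  apply Cder_quadratic with (M := 2 * Series M) (d := d); trivial. intros w Hw.
  assert (Hz : Cmod (z - z) < d).
  { replace (z - z)%C with (RtoC 0) by ring. now rewrite Cmod_0. }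
  assert (H1 := CSeries_correct (fun n => F n w) M (fun n => HF w n Hw) HM).
  assert (H2 := CSeries_correct (fun n => F n z) M (fun n => HF z n Hz) HM).
  assert (H3 := CSeries_correct D M HD HM).
  set (m := Cmod (w - z)) in *.
  assert (Hex : ex_series (fun n => M n * m ^ 2)) by now apply ex_series_scal_r.
  rewrite Rmult_assoc, <- Series_scal_r.
  apply (Cser_bound (fun n => (F n w - F n z - (w - z) * D n)%C) _ _ (fun n => HQ w n Hw) Hex).
  apply (Cser_scal (-1)) in H2. apply (Cser_scal (- (w - z))) in H3.
  pose proof (Cser_plus _ _ _ _ (Cser_plus _ _ _ _ H1 H2) H3) as H.
  replace (CSeries (fun n => F n w) - CSeries (fun n => F n z) - (w - z) * CSeries D)%C
    with (CSeries (fun n => F n w) + -1 * CSeries (fun n => F n z) + - (w - z) * CSeries D)%C by ring.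
  revert H. apply Cser_ext. intros n. ring.
Qed.

(** Comparison with the telescoping series of [2 (1/n - 1/(n+1))]. *)
Lemma ex_series_inv_sqr : ex_series (fun k => / INR (S k) ^ 2).
Proof.
  apply (ex_series_le (V := R_CompleteNormedModule) _ (fun k => 2 * (/ INR (S k) - / INR (S (S k))))).
  - intros k. change (Rabs (/ INR (S k) ^ 2) <= 2 * (/ INR (S k) - / INR (S (S k)))).
    rewrite (S_INR (S k)). assert (1 <= INR (S k)) by (rewrite S_INR; pose proof (pos_INR k); lra).
    set (x := INR (S k)) in *.
    rewrite Rabs_pos_eq by (left; apply Rinv_0_lt_compat; nra).
    replace (2 * (/ x - / (x + 1))) with (/ x ^ 2 * (2 * x / (x + 1))) by (field; lra).
    rewrite <- (Rmult_1_r (/ x ^ 2)) at 1. apply Rmult_le_compat_l.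
    + left; apply Rinv_0_lt_compat; nra.
    + apply (Rmult_le_reg_r (x + 1)); [lra|]. unfold Rdiv. rewrite Rmult_assoc, Rinv_l; lra.
  - apply (ex_series_scal_l (K := R_AbsRing) (V := R_NormedModule)). exists 1.
    apply is_series_Reals. intros eps He.
    destruct (archimed_cor1 eps He) as [N [HN HN0]].
    exists N. intros n Hn.
    assert (E : sum_f_R0 (fun k => / INR (S k) - / INR (S (S k))) n = 1 - / INR (S (S n))).
    { clear. induction n; [simpl; field|]. rewrite tech5, IHn. ring. }
    rewrite E. unfold Rdist. replace (1 - / INR (S (S n)) - 1) with (- / INR (S (S n))) by ring.
    assert (0 < INR N) by (apply lt_0_INR; lia).
    assert (INR N <= INR (S (S n))) by (apply le_INR; lia).
    rewrite Rabs_Ropp, Rabs_pos_eq by (left; apply Rinv_0_lt_compat; lra).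
    eapply Rle_lt_trans; [|exact HN]. apply Rinv_le_contravar; lra.
Qed.

(** * Euler-Boole remainders *)

Lemma Rcpow_plus (x : R) (a b : C) : Rcpow x (a + b) = (Rcpow x a * Rcpow x b)%C.
Proof. unfold Rcpow. rewrite <- Cexp_plus. f_equal. ring. Qed.

Lemma Cmod_Rcpow (x : R) (s : C) : Cmod (Rcpow x s) = exp (Re s * ln x).
Proof. unfold Rcpow. rewrite Cmod_Cexp. f_equal. unfold Re; simpl. ring. Qed.

Lemma Rcpow_opp_1 (x : R) : 0 < x -> Rcpow x (- (1)) = RtoC (/ x).
Proof.
  intros Hx. unfold Rcpow.
  replace (- (1) * RtoC (ln x))%C with (RtoC (- ln x)) by (apply C_ext; simpl; ring).
  unfold Cexp. simpl. rewrite cos_0, sin_0, exp_Ropp, exp_ln by trivial.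
  apply C_ext; simpl; ring.
Qed.

Lemma exp_ge_quarter_sqr (y : R) : 0 <= y -> y ^ 2 / 4 <= exp y.
Proof.
  intros Hy. replace (exp y) with (exp (y / 2) * exp (y / 2)) by (rewrite <- exp_plus; f_equal; field).
  pose proof (exp_ineq1_le (y / 2)). nra.
Qed.

(** With [L = ln x] and [m = |h|], the error of [Cexp] is at most [5 (m L)^2 exp (m L)]. Both
    [L^2 <= 64 exp (L/4)] and [exp (m L) <= exp (L/4)] cost a quarter power of [x], paid from the
    gap between exponents 4 and 3; 320 is [5 * 64]. *)
Lemma Rcpow_quadratic (x : R) (s h : C) : 1 <= x -> 4 < Re s -> Cmod h < 1 / 4 ->
  Cmod (Rcpow x (- (s + h)) - Rcpow x (- s) - h * (RtoC (- ln x) * Rcpow x (- s)))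
  <= 320 * exp (- (3 * ln x)) * Cmod h ^ 2.
Proof.
  intros Hx Hs Hh.
  assert (HL : 0 <= ln x) by (rewrite <- ln_1; apply ln_le; lra).
  set (L := ln x) in *.
  replace (- (s + h))%C with (- s + - h)%C by ring. rewrite Rcpow_plus.
  replace (Rcpow x (- s) * Rcpow x (- h) - Rcpow x (- s) - h * (RtoC (- L) * Rcpow x (- s)))%C
    with (Rcpow x (- s) * (Rcpow x (- h) - 1 - - h * RtoC L))%C.
  2:{ replace (RtoC (- L)) with (- RtoC L)%C by (apply C_ext; simpl; ring). ring. }
  rewrite Cmod_mult, Cmod_Rcpow. fold L. unfold Rcpow; fold L.
  eapply Rle_trans; [apply Rmult_le_compat_l; [left; apply exp_pos|apply Cexp_bound2]|].
  rewrite Cmod_mult, Cmod_opp, Cmod_R, (Rabs_pos_eq L) by trivial.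
  set (m := Cmod h) in *. assert (0 <= m) by apply Cmod_ge_0.
  assert (H1 : L ^ 2 <= 64 * exp (L / 4)).
  { pose proof (exp_ge_quarter_sqr (L / 4)). replace ((L / 4) ^ 2 / 4) with (L ^ 2 / 64) in H0 by field. lra. }
  assert (H2 : exp (m * L) <= exp (L / 4)) by (apply exp_le; nra).
  assert (H3 : exp (Re (- s) * L) <= exp (- (4 * L))) by (apply exp_le; simpl; unfold Re in *; nra).
  assert (H4 : exp (- (4 * L)) * (exp (L / 4) * exp (L / 4)) <= exp (- (3 * L))).
  { rewrite <- !exp_plus. apply exp_le. lra. }
  pose proof (exp_pos (m * L)). pose proof (exp_pos (L / 4)). pose proof (exp_pos (- (4 * L))).
  apply Rle_trans with (exp (- (4 * L)) * (5 * (m ^ 2 * (64 * exp (L / 4))) * exp (L / 4))).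
  - apply Rmult_le_compat; trivial; try (left; apply exp_pos).
    + apply Rmult_le_pos; [|lra]. apply Rmult_le_pos; [lra|apply pow2_ge_0].
    + apply Rmult_le_compat; [|lra| |exact H2].
      * apply Rmult_le_pos; [lra|apply pow2_ge_0].
      * rewrite Rpow_mult_distr. apply Rmult_le_compat_l; [lra|].
        apply Rmult_le_compat_l; [apply pow2_ge_0|exact H1].
  - replace (exp (- (4 * L)) * (5 * (m ^ 2 * (64 * exp (L / 4))) * exp (L / 4)))
      with (320 * (exp (- (4 * L)) * (exp (L / 4) * exp (L / 4))) * m ^ 2) by ring.
    apply Rmult_le_compat_r; [nra|lra].
Qed.

Lemma Rcpow_bound (x : R) (s : C) : 1 <= x -> 3 <= Re s ->
  Cmod (Rcpow x (- s)) <= exp (- (3 * ln x)).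
Proof.
  intros Hx Hs. assert (HL : 0 <= ln x) by (rewrite <- ln_1; apply ln_le; lra).
  rewrite Cmod_Rcpow. apply exp_le. simpl. unfold Re in *. nra.
Qed.

Lemma ln_Rcpow_bound (x : R) (s : C) : 1 <= x -> 4 < Re s ->
  Cmod (RtoC (- ln x) * Rcpow x (- s)) <= 320 * exp (- (3 * ln x)).
Proof.
  intros Hx Hs. assert (HL : 0 <= ln x) by (rewrite <- ln_1; apply ln_le; lra).
  rewrite Cmod_mult, Cmod_R, Cmod_Rcpow, Rabs_Ropp, Rabs_pos_eq by trivial.
  set (L := ln x) in *.
  apply Rle_trans with (exp L * exp (- (4 * L))).
  - apply Rmult_le_compat; trivial; [left; apply exp_pos| |].
    + pose proof (exp_ineq1_le L); lra.
    + apply exp_le. simpl. unfold Re in *. nra.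
  - rewrite <- exp_plus. replace (L + - (4 * L)) with (- (3 * L)) by ring.
    pose proof (exp_pos (- (3 * L))); lra.
Qed.

Definition kernel_int (w : R -> R) (s : C) (k : nat) : C :=
  CInt (fun t => (RtoC (w (1 - t)%R) * Rcpow (INR (S k) + t)%R (- s))%C) 0 1.

Lemma INR_S_ge_1 (k : nat) : 1 <= INR (S k).
Proof. rewrite S_INR; pose proof (pos_INR k); lra. Qed.

Lemma CexInt_kernel (g : R -> R) (s : C) (x : R) : 1 <= x ->
  (forall t, 0 <= t <= 1 -> ex_derive g t) ->
  CexInt (fun t => (RtoC (g t) * Rcpow (x + t)%R (- s))%C) 0 1.
Proof.
  intros Hx Hg. destruct s as [s1 s2].
  split; apply (ex_RInt_continuous (V := R_CompleteNormedModule)); intros t Ht;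
    rewrite Rmin_left, Rmax_right in Ht by lra;
    apply (ex_derive_continuous (K := R_AbsRing) (V := R_NormedModule)); simpl;
    auto_derive; refine (conj _ (conj _ _)); try lra; try (apply Hg; trivial); auto;
    try (split; [lra|trivial]).
Qed.

Ltac solve_side := repeat match goal with
  | |- _ /\ _ => split
  | |- True => exact I
  | H : forall t, ex_derive ?w t |- ex_derive (fun x => ?w x) _ => apply H
  | |- _ => lra
  end.

(** The fundamental theorem for [w(1 - t) (x + t)^(-s)] on [[0, 1]]; reversing the argument of [w]
    puts [w 0] at [x + 1] and [w 1] at [x]. *)
Lemma kernel_int_parts (w v : R -> R) (s : C) (k : nat) :
  (forall t, is_derive w t (v t)) -> (forall t, ex_derive v t) ->
  (RtoC (w 0%R) * Rcpow (INR (S (S k))) (- s) - RtoC (w 1%R) * Rcpow (INR (S k)) (- s))%C =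
  (- kernel_int v s k - s * kernel_int w (s + 1) k)%C.
Proof.
  intros Hw Hv. set (x := INR (S k)).
  assert (Hx : 1 <= x) by apply INR_S_ge_1.
  assert (Hw1 : forall t, ex_derive (fun t => w (1 - t)%R) t).
  { intros t. auto_derive. exists (v (1 - t)). apply Hw. }
  assert (Hv1 : forall t, ex_derive (fun t => v (1 - t)%R) t).
  { intros t. auto_derive. apply Hv. }
  assert (I1 := CexInt_kernel (fun t => v (1 - t)%R) s x Hx (fun t _ => Hv1 t)).
  assert (I2 := CexInt_kernel (fun t => w (1 - t)%R) (s + 1) x Hx (fun t _ => Hw1 t)).
  destruct (CInt_scal (-1) _ 0 1 I1) as [J1 K1].
  destruct (CInt_scal (- s) _ 0 1 I2) as [J2 K2].
  replace (- kernel_int v s k - s * kernel_int w (s + 1) k)%C with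
    (-1 * kernel_int v s k + - s * kernel_int w (s + 1) k)%C by ring.
  unfold kernel_int. fold x. rewrite <- K1, <- K2, <- CInt_plus by trivial.
  replace (INR (S (S k))) with (x + 1) by (unfold x; rewrite (S_INR (S k)); ring).
  destruct (CInt_FTC (fun t => (RtoC (w (1 - t)%R) * Rcpow (x + t)%R (- s))%C)
    (fun t => (-1 * (RtoC (v (1 - t)%R) * Rcpow (x + t)%R (- s)) +
       - s * (RtoC (w (1 - t)%R) * (RtoC (/ (x + t)%R) * Rcpow (x + t)%R (- s))))%C) 0 1) as [_ E]; [lra| |].
  - intros t Ht. destruct s as [s1 s2]. simpl.
    pose proof (Hw (1 - t)%R) as Hwt.
    assert (Ew : Derive w (1 - t) = v (1 - t)%R) by (apply is_derive_unique, Hwt).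
    assert (Hwe : forall t, ex_derive w t) by (intros t'; exists (v t'); apply Hw).
    refine (conj _ (conj _ (conj _ _))).
    + auto_derive; [solve_side|].
      change (fun x : R => w x) with w. unfold Rminus in *. rewrite Ew. field. lra.
    + auto_derive; [solve_side|].
      change (fun x : R => w x) with w. unfold Rminus in *. rewrite Ew. field. lra.
    + apply (ex_derive_continuous (K := R_AbsRing) (V := R_NormedModule)).
      auto_derive. solve_side.
    + apply (ex_derive_continuous (K := R_AbsRing) (V := R_NormedModule)).
      auto_derive. solve_side.
  - rewrite Rplus_0_r in E. replace (1 - 1) with 0 in E by ring. rewrite Rminus_0_r in E. rewrite <- E.
    unfold CInt. f_equal; apply RInt_ext; intros t Ht; rewrite Rmin_left, Rmax_right in Ht by lra;
      f_equal; (replace (- (s + 1))%C with (- (1) + - s)%C by ring);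
      rewrite Rcpow_plus, Rcpow_opp_1 by lra; reflexivity.
Qed.

Lemma exp_ln_cube_bound (k : nat) (x : R) : INR (S k) <= x ->
  exp (- (3 * ln x)) <= / INR (S k) ^ 3.
Proof.
  intros Hx. pose proof (INR_S_ge_1 k) as Hk.
  set (n := INR (S k)) in *.
  rewrite exp_Ropp. apply Rinv_le_contravar; [apply pow_lt; lra|].
  replace (3 * ln x) with (ln x + ln x + ln x) by ring.
  rewrite !exp_plus, exp_ln by lra.
  replace (n ^ 3) with (n * n * n) by ring.
  apply Rmult_le_compat; [nra|lra| |exact Hx]. apply Rmult_le_compat; lra.
Qed.

Section Kernel.

Variables (w : R -> R) (W : R) (a : nat -> R).
Hypothesis Hw : forall t, ex_derive w t.
Hypothesis HW : forall t, 0 <= t <= 1 -> Rabs (w t) <= W.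
Hypothesis Ha : forall k, Rabs (a k) <= INR (S k).

Let W_pos : 0 <= W.
Proof. eapply Rle_trans; [apply Rabs_pos|apply (HW 0); lra]. Qed.

(** The growth of [a k] uses up one of the three powers and leaves a summable [1/k^2]. *)
Lemma weighted_bound (f : R -> C) (c : R) (k : nat) : 0 <= c ->
  CexInt (fun t => (RtoC (w (1 - t)%R) * f t)%C) 0 1 ->
  (forall t, 0 <= t <= 1 -> Cmod (f t) <= exp (- (3 * ln (INR (S k) + t))) * c) ->
  Cmod (RtoC (a k) * CInt (fun t => (RtoC (w (1 - t)%R) * f t)%C) 0 1) <= 2 * W * c * / INR (S k) ^ 2.
Proof.
  intros Hc Hex Hf. pose proof (INR_S_ge_1 k) as Hk.
  assert (H3 : 0 < / INR (S k) ^ 3) by (apply Rinv_0_lt_compat, pow_lt; lra).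
  rewrite Cmod_mult, Cmod_R.
  apply Rle_trans with (INR (S k) * (2 * (W * (/ INR (S k) ^ 3 * c)) * (1 - 0))).
  - apply Rmult_le_compat; [apply Rabs_pos|apply Cmod_ge_0|apply Ha|].
    apply CInt_bound; [lra|exact Hex|]. intros t Ht.
    rewrite Cmod_mult, Cmod_R. apply Rmult_le_compat; [apply Rabs_pos|apply Cmod_ge_0|apply HW; lra|].
    eapply Rle_trans; [apply Hf; lra|]. apply Rmult_le_compat_r; trivial.
    apply exp_ln_cube_bound. lra.
  - right. field. lra.
Qed.

(** The constant [640 = 2 * 320] is larger than this bound requires: it makes the majorant the one
    used for derivatives and remainders in [Cder_kernel_sum]. *)
Lemma kernel_term_bound (s : C) (k : nat) : 3 <= Re s ->
  Cmod (RtoC (a k) * kernel_int w s k) <= 640 * W * / INR (S k) ^ 2.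
Proof.
  intros Hs. pose proof (INR_S_ge_1 k) as Hk.
  assert (H2 : 0 < / INR (S k) ^ 2) by (apply Rinv_0_lt_compat, pow_lt; lra).
  apply Rle_trans with (2 * W * 1 * / INR (S k) ^ 2).
  - apply weighted_bound; [lra| |].
    + apply (CexInt_kernel (fun t => w (1 - t))); trivial.
      intros t _. auto_derive. solve_side.
    + intros t Ht. rewrite Rmult_1_r. apply Rcpow_bound; trivial; lra.
  - apply Rmult_le_compat_r; lra.
Qed.

Lemma kernel_sum_correct (s : C) : 3 <= Re s ->
  Cser (fun k => (RtoC (a k) * kernel_int w s k)%C)
    (CSeries (fun k => (RtoC (a k) * kernel_int w s k)%C)).
Proof.
  intros Hs. apply (CSeries_correct _ (fun k => 640 * W * / INR (S k) ^ 2)).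
  - intros k. now apply kernel_term_bound.
  - apply (ex_series_scal_l (K := R_AbsRing) (V := R_NormedModule)). exact ex_series_inv_sqr.
Qed.

Lemma Cder_kernel_sum (s : C) : 4 < Re s -> exists l,
  Cder (fun z => CSeries (fun k => (RtoC (a k) * kernel_int w z k)%C)) s l.
Proof.
  intros Hs.
  set (d := Rmin (1 / 4) (Re s - 4)).
  assert (Hd : 0 < d) by (apply Rmin_pos; lra).
  assert (Hd1 : d <= 1 / 4) by apply Rmin_l.
  assert (HexD : forall k, CexInt (fun t => (RtoC (w (1 - t)%R) *
      (RtoC (- ln (INR (S k) + t)) * Rcpow (INR (S k) + t)%R (- s)))%C) 0 1).
  { intros k. pose proof (INR_S_ge_1 k) as Hk.
    generalize dependent (INR (S k)). intros n Hk.
    (* The logarithm is real, so it is counted as part of the weight. *)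
    assert (H := CexInt_kernel (fun t => w (1 - t) * - ln (n + t)) s n Hk).
    destruct H as [H1 H2].
    { intros t Ht. auto_derive. solve_side. }
    split.
      + revert H1. apply ex_RInt_ext. intros t _. unfold Re; simpl; ring.
      + revert H2. apply ex_RInt_ext. intros t _. unfold Im; simpl; ring. }
  eexists.
  apply (Cder_series (fun k z => (RtoC (a k) * kernel_int w z k)%C)
    (fun k => (RtoC (a k) * CInt (fun t => (RtoC (w (1 - t)%R) *
      (RtoC (- ln (INR (S k) + t)) * Rcpow (INR (S k) + t)%R (- s)))%C) 0 1)%C)
    (fun k => 640 * W * / INR (S k) ^ 2) s d); trivial.
  - apply (ex_series_scal_l (K := R_AbsRing) (V := R_NormedModule)). exact ex_series_inv_sqr.
  - intros k. replace (640 * W) with (2 * W * 320) by ring.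
    apply weighted_bound; [lra|apply HexD|]. intros t Ht. rewrite Rmult_comm.
    apply ln_Rcpow_bound; trivial. pose proof (INR_S_ge_1 k); lra.
  - intros z k Hz. apply kernel_term_bound.
    pose proof (re_le_Cmod (z - s)) as Hr. apply Rabs_le_between in Hr.
    simpl in Hr. unfold Re in *. lra.
  - intros z k Hz. pose proof (INR_S_ge_1 k) as Hk.
    set (h := (z - s)%C) in *.
    assert (Hw1 : forall t, 0 <= t <= 1 -> ex_derive (fun t => w (1 - t)) t).
    { intros t _. auto_derive. solve_side. }
    pose proof (CexInt_kernel (fun t => w (1 - t)) z (INR (S k)) Hk Hw1) as Iz.
    pose proof (CexInt_kernel (fun t => w (1 - t)) s (INR (S k)) Hk Hw1) as Is.
    destruct (CInt_scal (-1) _ 0 1 Is) as [Js Ks].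
    destruct (CInt_scal (- h) _ 0 1 (HexD k)) as [Jd Kd].
    pose proof (CexInt_plus _ _ 0 1 (CexInt_plus _ _ 0 1 Iz Js) Jd) as Hex.
    set (D := CInt (fun t => (RtoC (w (1 - t)%R) *
      (RtoC (- ln (INR (S k) + t)) * Rcpow (INR (S k) + t)%R (- s)))%C) 0 1) in Kd |- *.
    assert (E : (RtoC (a k) * kernel_int w z k - RtoC (a k) * kernel_int w s k - h * (RtoC (a k) * D))%C =
      (RtoC (a k) * CInt (fun t => RtoC (w (1 - t)%R) *
        (Rcpow (INR (S k) + t)%R (- z) - Rcpow (INR (S k) + t)%R (- s)
         - h * (RtoC (- ln (INR (S k) + t)) * Rcpow (INR (S k) + t)%R (- s)))) 0 1)%C).
    { rewrite (CInt_ext _ (fun t => (RtoC (w (1 - t)%R) * Rcpow (INR (S k) + t)%R (- z)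
        + -1 * (RtoC (w (1 - t)%R) * Rcpow (INR (S k) + t)%R (- s))
        + - h * (RtoC (w (1 - t)%R) * (RtoC (- ln (INR (S k) + t)) * Rcpow (INR (S k) + t)%R (- s))))%C)).
      2:{ intros t. ring. }
      rewrite CInt_plus; trivial. 2:{ apply CexInt_plus; trivial. }
      rewrite CInt_plus; trivial. rewrite Ks, Kd. unfold kernel_int. ring. }
    rewrite E. pose proof (Cmod_ge_0 h) as Hh.
    replace (640 * W * / INR (S k) ^ 2 * Cmod h ^ 2) with (2 * W * (320 * Cmod h ^ 2) * / INR (S k) ^ 2) by (field; lra).
    apply weighted_bound.
    + apply Rmult_le_pos; [lra|apply pow2_ge_0].
    + revert Hex. intros [H1 H2]; split.
      * revert H1. apply ex_RInt_ext. intros t _. apply (f_equal Re). ring.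
      * revert H2. apply ex_RInt_ext. intros t _. apply (f_equal Im). ring.
    + intros t Ht. replace z with (s + h)%C by (unfold h; ring).
      eapply Rle_trans; [apply Rcpow_quadratic; lra|]. right. ring.
Qed.

End Kernel.

(** * Continuation of alternating series *)

(* For [c m = E_m(0) / m!] this is the Euler polynomial [E_K(t) / K!]. *)
Definition weight (c : nat -> R) (K : nat) (t : R) : R :=
  sum_f_R0 (fun i => c (K - i)%nat * (t ^ i / INR (fact i))) K.

Lemma is_derive_exp_sum (b : nat -> R) (N : nat) (t : R) :
  is_derive (fun t => sum_f_R0 (fun i => b i * (t ^ i / INR (fact i))) (S N)) t
    (sum_f_R0 (fun i => b (S i) * (t ^ i / INR (fact i))) N).
Proof.
  assert (Hs : forall n, is_derive (fun t => b (S n) * (t ^ S n / INR (fact (S n)))) t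
    (b (S n) * (t ^ n / INR (fact n)))).
  { intros n. pose proof (INR_fact_neq_0 n). pose proof (INR_fact_neq_0 (S n)) as Hn.
    assert (Hf : INR (fact (S n)) = INR (S n) * INR (fact n)).
    { change (fact (S n)) with (S n * fact n)%nat. apply mult_INR. }
    assert (INR (S n) <> 0) by (apply not_0_INR; lia).
    set (F := INR (fact (S n))) in *.
    auto_derive; [trivial|]. rewrite Hf.
    change (match n with O => 1 | S _ => INR n + 1 end) with (INR (S n)). simpl pred.
    field; auto. }
  induction N.
  - simpl sum_f_R0. apply (is_derive_ext (fun t => b 0%nat * (1 / 1) + b 1%nat * (t ^ 1 / INR (fact 1)))).
    { intros x. reflexivity. }
    rewrite <- (Rplus_0_l (b 1%nat * _)).
    apply @is_derive_plus; [apply @is_derive_const|apply Hs].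
  - change (sum_f_R0 (fun i => b (S i) * (t ^ i / INR (fact i))) (S N)) with
      (sum_f_R0 (fun i => b (S i) * (t ^ i / INR (fact i))) N + b (S (S N)) * (t ^ S N / INR (fact (S N)))).
    apply (@is_derive_plus R_AbsRing R_NormedModule
      (fun t => sum_f_R0 (fun i => b i * (t ^ i / INR (fact i))) (S N))
      (fun t => b (S (S N)) * (t ^ S (S N) / INR (fact (S (S N)))))); [exact IHN|apply Hs].
Qed.

(** The Appell property [E_(K+1)' = (K + 1) E_K], normalised by factorials. *)
Lemma is_derive_weight (c : nat -> R) (K : nat) (t : R) :
  is_derive (weight c (S K)) t (weight c K t).
Proof. apply (is_derive_exp_sum (fun i => c (S K - i)%nat)). Qed.

Lemma ex_derive_weight (c : nat -> R) (K : nat) (t : R) : ex_derive (weight c K) t.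
Proof.
  destruct K.
  - unfold weight; simpl. apply @ex_derive_const.
  - eexists; apply is_derive_weight.
Qed.

Lemma weight_at_0 (c : nat -> R) (K : nat) : weight c K 0 = c K.
Proof.
  unfold weight. destruct K; [simpl; field|].
  rewrite decomp_sum by lia. simpl pred.
  rewrite (sum_eq _ (fun _ => 0)).
  - rewrite sum_eq_R0 by trivial. rewrite Nat.sub_0_r. simpl. field.
  - intros i _. simpl (0 ^ S i). unfold Rdiv. ring.
Qed.

Lemma weight_bounded (c : nat -> R) (K : nat) :
  exists W, forall t, 0 <= t <= 1 -> Rabs (weight c K t) <= W.
Proof.
  destruct (continuity_ab_maj (fun t => Rabs (weight c K t)) 0 1) as [m [Hm _]]; [lra| |].
  - intros t _. apply (continuity_pt_comp (weight c K) Rabs); [|apply Rcontinuity_abs].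
    apply continuity_pt_filterlim, (ex_derive_continuous (K := R_AbsRing) (V := R_NormedModule)), ex_derive_weight.
  - eexists; exact Hm.
Qed.

(* [(-1)^m s (s + 1) ... (s + m - 1)]: the [m]-th derivative of [x^(-s)] is [rising s m * x^(-s-m)]. *)
Fixpoint rising (s : C) (m : nat) : C :=
  match m with
  | O => RtoC 1
  | S k => (rising s k * - (s + RtoC (INR k)))%C
  end.

(** Used both with the entire [G] and, for a fixed [k], with [G(z) = (k+1)^(-z) + (k+2)^(-z)], where
    it is the main part of the Euler-Boole identity. *)
Fixpoint shifted_sum (c : nat -> R) (G : C -> C) (K : nat) (s : C) : C :=
  match K with
  | O => RtoC 0
  | S k => (shifted_sum c G k s + RtoC (c k) * rising s k * G (s + RtoC (INR k)))%C
  end.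

Section Continuation.

Variables (c a : nat -> R) (G : C -> C).
Hypothesis Hc0 : c O = 1.
(** The reflection [E_K(1) = - E_K(0)] for [K >= 1], the only property of the Euler numbers besides
    [c 0 = 1] that enters the continuation. *)
Hypothesis HcS : forall K, weight c (S K) 1 = - c (S K).
Hypothesis Ha : forall k, Rabs (a k) <= INR (S k).
Hypothesis HG : entire G.
Hypothesis HGs : forall s, 0 < Re s ->
  Cser (fun k => (RtoC ((-1) ^ k * a k) *
    (Rcpow (INR (S k)) (- s) + Rcpow (INR (S (S k))) (- s)))%C) (G s).

Let e (k : nat) : R := (-1) ^ k * a k.

Let He (k : nat) : Rabs (e k) <= INR (S k).
Proof. unfold e. rewrite Rabs_mult, pow_1_abs, Rmult_1_l. apply Ha. Qed.

Let remainder (K : nat) (s : C) : C :=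
  (rising s (S K) *
   CSeries (fun k => RtoC (e k) * kernel_int (weight c K) (s + RtoC (INR (S K))) k))%C.

(** The continuation at level [K], halved because Euler-Boole expands [2 phi]. Far to the left its
    [CSeries] may diverge and the value mean nothing, hence the bound on [Re s + INR (S K)] in the
    lemmas below. *)
Let halfplane (K : nat) (s : C) : C := (RtoC (1 / 2) * (shifted_sum c G (S K) s - remainder K s))%C.

Lemma remainder_series (K : nat) (s : C) : 3 <= Re s + INR (S K) ->
  Cser (fun k => (rising s (S K) * (RtoC (e k) * kernel_int (weight c K) (s + RtoC (INR (S K))) k))%C)
    (remainder K s).
Proof.
  intros Hs. apply Cser_scal. destruct (weight_bounded c K) as [W HW].
  apply (kernel_sum_correct (weight c K) W e (ex_derive_weight c K) HW He).
  exact Hs.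
Qed.

(** One integration by parts. The boundary weights are [c (S K)] at 0 and [- c (S K)] at 1, so the
    boundary difference becomes the sum of the values at [k + 1] and [k + 2]. *)
Lemma rising_kernel_step (K : nat) (s : C) (k : nat) :
  (RtoC (c (S K)) * rising s (S K) *
    (Rcpow (INR (S k)) (- (s + RtoC (INR (S K)))) + Rcpow (INR (S (S k))) (- (s + RtoC (INR (S K))))))%C =
  (rising s (S (S K)) * kernel_int (weight c (S K)) (s + RtoC (INR (S (S K)))) k
   - rising s (S K) * kernel_int (weight c K) (s + RtoC (INR (S K))) k)%C.
Proof.
  pose proof (kernel_int_parts (weight c (S K)) (weight c K) (s + RtoC (INR (S K))) k
    (is_derive_weight c K) (ex_derive_weight c K)) as H.
  rewrite weight_at_0, HcS in H.
  replace (s + RtoC (INR (S (S K))))%C with (s + RtoC (INR (S K)) + 1)%C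
    by (rewrite (S_INR (S K)), RtoC_plus; ring).
  change (rising s (S (S K))) with (rising s (S K) * - (s + RtoC (INR (S K))))%C.
  rewrite RtoC_opp in H.
  set (r := rising s (S K)) in *. set (z := (s + RtoC (INR (S K)))%C) in *.
  transitivity (r * (RtoC (c (S K)) * Rcpow (INR (S (S k))) (- z) - - RtoC (c (S K)) * Rcpow (INR (S k)) (- z)))%C;
    [ring|]. rewrite H. ring.
Qed.

(** [rising_kernel_step] summed over [k]: the left side adds up to a value of [G], the new summand
    of [shifted_sum]. The argument of [G] has positive real part even where the original series
    diverges, so consecutive levels agree there too. *)
Lemma halfplane_step (K : nat) (s : C) : 3 <= Re s + INR (S K) -> halfplane (S K) s = halfplane K s.
Proof.
  intros Hs.
  assert (Hs' : 3 <= Re s + INR (S (S K))) by (rewrite (S_INR (S K)); lra).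
  assert (H : (RtoC (c (S K)) * rising s (S K) * G (s + RtoC (INR (S K))))%C = (remainder (S K) s + -1 * remainder K s)%C).
  { eapply Cser_unique.
    - apply Cser_scal. apply HGs. change (0 < Re s + INR (S K)). lra.
    - pose proof (Cser_plus _ _ _ _ (remainder_series (S K) s Hs') (Cser_scal (-1) _ _ (remainder_series K s Hs))) as H.
      revert H. apply Cser_ext. intros k.
      pose proof (rising_kernel_step K s k) as E.
      set (r1 := rising s (S K)) in *. set (r2 := rising s (S (S K))) in *. fold (e k).
      transitivity (RtoC (e k) * (r2 * kernel_int (weight c (S K)) (s + RtoC (INR (S (S K)))) k
        - r1 * kernel_int (weight c K) (s + RtoC (INR (S K))) k))%C; [ring|].
      rewrite <- E. ring. }
  unfold halfplane.
  change (shifted_sum c G (S (S K)) s) with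
    (shifted_sum c G (S K) s + RtoC (c (S K)) * rising s (S K) * G (s + RtoC (INR (S K))))%C.
  rewrite H. ring.
Qed.

Lemma halfplane_stable (K j : nat) (s : C) : 3 <= Re s + INR (S K) -> halfplane (K + j) s = halfplane K s.
Proof.
  intros Hs. induction j; [now rewrite Nat.add_0_r|].
  rewrite Nat.add_succ_r, halfplane_step; trivial.
  rewrite S_INR, plus_INR. rewrite S_INR in Hs. pose proof (pos_INR j). lra.
Qed.

Let head (K : nat) (s : C) (k : nat) : C :=
  shifted_sum c (fun z => (Rcpow (INR (S k)) (- z) + Rcpow (INR (S (S k))) (- z))%C) (S K) s.

(** Induction on [K], each step trading the remainder for one more pair of boundary terms by
    [rising_kernel_step]. *)
Lemma euler_boole (K : nat) (s : C) (k : nat) :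
  (RtoC 2 * Rcpow (INR (S k)) (- s))%C =
  (head K s k - rising s (S K) * kernel_int (weight c K) (s + RtoC (INR (S K))) k)%C.
Proof.
  induction K.
  - assert (Hd : forall t, is_derive (weight c 0) t 0).
    { intros t. unfold weight; simpl. apply @is_derive_const. }
    pose proof (kernel_int_parts (weight c 0) (fun _ => 0) s k Hd (fun t => ex_derive_const 0 t)) as H.
    assert (Hw : forall t, weight c 0 t = 1) by (intros; unfold weight; simpl; rewrite Hc0; field).
    rewrite !Hw in H.
    assert (H0 : kernel_int (fun _ => 0) s k = 0).
    { unfold kernel_int. rewrite (CInt_ext _ (fun _ => RtoC 0)) by (intros; ring).
      apply C_ext; unfold CInt; simpl; rewrite RInt_const; apply Rmult_0_r. }
    rewrite H0 in H. unfold head.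
    change (rising s 1) with (1 * - (s + 0))%C.
    change (INR 1) with 1.
    change (shifted_sum c (fun z => (Rcpow (INR (S k)) (- z) + Rcpow (INR (S (S k))) (- z))%C) 1 s)
      with (0 + RtoC (c 0%nat) * 1 * (Rcpow (INR (S k)) (- (s + 0)) + Rcpow (INR (S (S k))) (- (s + 0))))%C.
    rewrite Hc0. replace (s + 0)%C with s by ring.
    set (I := kernel_int (weight c 0) (s + 1) k) in *.
    set (A := Rcpow (INR (S k)) (- s)) in *. set (B := Rcpow (INR (S (S k))) (- s)) in *.
    replace (RtoC 2) with (RtoC 1 + RtoC 1)%C by (rewrite <- RtoC_plus; f_equal; ring).
    (* The base case is [2 phi(x) = (phi(x) + phi(x+1)) - (phi(x+1) - phi(x))], with the last
       difference written as an integral of the derivative. *)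
    replace ((1 + 1) * A)%C with (0 + 1 * 1 * (A + B) + - (1 * B - 1 * A))%C by ring.
    rewrite H. ring.
  - rewrite IHK. unfold head.
    pose proof (rising_kernel_step K s k) as E.
    set (g := fun z => (Rcpow (INR (S k)) (- z) + Rcpow (INR (S (S k))) (- z))%C).
    change (shifted_sum c g (S (S K)) s) with
      (shifted_sum c g (S K) s + RtoC (c (S K)) * rising s (S K) * g (s + RtoC (INR (S K))))%C.
    change (g (s + RtoC (INR (S K)))%C) with (Rcpow (INR (S k)) (- (s + RtoC (INR (S K)))) +
      Rcpow (INR (S (S k))) (- (s + RtoC (INR (S K)))))%C.
    rewrite E. ring.
Qed.

Lemma head_series (K : nat) (s : C) : 0 < Re s ->
  Cser (fun k => (RtoC (e k) * head K s k)%C) (shifted_sum c G (S K) s).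
Proof.
  intros Hs. unfold head. set (N := S K). clearbody N. induction N.
  - simpl. replace (RtoC 0) with (0 * G s)%C by ring.
    apply (Cser_ext (fun k => (0 * (RtoC (e k) * (Rcpow (INR (S k)) (- s) + Rcpow (INR (S (S k))) (- s))))%C)).
    + intros k. ring.
    + apply Cser_scal. now apply HGs.
  - change (shifted_sum c G (S N) s) with
      (shifted_sum c G N s + RtoC (c N) * rising s N * G (s + RtoC (INR N)))%C.
    assert (HN : 0 < Re (s + RtoC (INR N))).
    { change (0 < Re s + INR N). pose proof (pos_INR N); lra. }
    pose proof (Cser_plus _ _ _ _ IHN (Cser_scal (RtoC (c N) * rising s N) _ _ (HGs _ HN))) as H.
    revert H. apply Cser_ext. intros k. fold (e k).
    set (g := fun z => (Rcpow (INR (S k)) (- z) + Rcpow (INR (S (S k))) (- z))%C).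
    change (shifted_sum c g (S N) s) with
      (shifted_sum c g N s + RtoC (c N) * rising s N * g (s + RtoC (INR N)))%C.
    unfold g at 3. ring.
Qed.

Lemma halfplane_series (K : nat) (s : C) : 0 < Re s -> 3 <= Re s + INR (S K) ->
  Cser (fun k => (RtoC (e k) * Rcpow (INR (S k)) (- s))%C) (halfplane K s).
Proof.
  intros Hs HK. unfold halfplane.
  replace (RtoC (1 / 2) * (shifted_sum c G (S K) s - remainder K s))%C with
    (RtoC (1 / 2) * (shifted_sum c G (S K) s + -1 * remainder K s))%C by ring.
  pose proof (Cser_scal (RtoC (1 / 2)) _ _ (Cser_plus _ _ _ _ (head_series K s Hs)
    (Cser_scal (-1) _ _ (remainder_series K s HK)))) as H.
  revert H. apply Cser_ext. intros k.
  pose proof (euler_boole K s k) as E.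
  set (r := rising s (S K)) in *. set (h := head K s k) in *.
  transitivity (RtoC (1 / 2) * RtoC (e k) * (h - r * kernel_int (weight c K) (s + RtoC (INR (S K))) k))%C; [ring|].
  rewrite <- E.
  replace (RtoC (1 / 2)) with (/ RtoC 2)%C by (rewrite <- RtoC_inv by lra; f_equal; field).
  field.
Qed.

Lemma Cder_rising (m : nat) (s : C) : exists l, Cder (fun z => rising z m) s l.
Proof.
  induction m as [|m [l Hl]]; simpl; eexists; [cder|].
  apply (Cder_ext (fun z => (rising z m * (-1 * (z + RtoC (INR m))))%C)); [intros; ring|].
  cder.
Qed.

Lemma Cder_shifted_sum (K : nat) (s : C) : exists l, Cder (fun z => shifted_sum c G K z) s l.
Proof.
  induction K as [|K [l Hl]]; simpl.
  - eexists; cder.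
  - destruct (Cder_rising K s) as [r Hr].
    destruct (proj1 (entire_Cder G) HG (s + RtoC (INR K))%C) as [g Hg].
    assert (Hg' : Cder (fun z => G (z + RtoC (INR K))%C) s ((1 + 0) * g)%C).
    { refine (Cder_comp G (fun z => (z + RtoC (INR K))%C) _ _ _ Hg _). cder. }
    eexists. cder.
Qed.

Lemma Cder_halfplane (K : nat) (s : C) : 4 < Re s + INR (S K) -> exists l, Cder (halfplane K) s l.
Proof.
  intros Hs. destruct (Cder_shifted_sum (S K) s) as [l1 H1]. destruct (Cder_rising (S K) s) as [l2 H2].
  destruct (weight_bounded c K) as [W HW].
  destruct (Cder_kernel_sum (weight c K) W e (ex_derive_weight c K) HW He (s + RtoC (INR (S K)))%C Hs) as [l3 H3].
  assert (H4 : Cder (fun z => CSeries (fun k => (RtoC (e k) * kernel_int (weight c K) (z + RtoC (INR (S K))) k)%C)) s ((1 + 0) * l3)%C).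
  { refine (Cder_comp (fun z => CSeries (fun k => (RtoC (e k) * kernel_int (weight c K) z k)%C))
      (fun z => (z + RtoC (INR (S K)))%C) _ _ _ H3 _). cder. }
  pose proof (Cder_mult _ _ _ _ _ H2 H4) as H5.
  eexists.
  apply (Cder_ext (fun z => (RtoC (1 / 2) * (shifted_sum c G (S K) z + -1 * remainder K z))%C)).
  { intros z. unfold halfplane. ring. }
  refine (Cder_mult (fun _ => RtoC (1 / 2)) (fun z => (shifted_sum c G (S K) z + -1 * remainder K z)%C) _ _ _ (Cder_const _ _) _).
  refine (Cder_plus (fun z => shifted_sum c G (S K) z) (fun z => (-1 * remainder K z)%C) _ _ _ H1 _).
  exact (Cder_mult (fun _ => RtoC (-1)) (remainder K) _ _ _ (Cder_const _ _) H5).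
Qed.

(** Large enough that [halfplane (level s)] is holomorphic at [s] and still valid within distance 1,
    and at least [n] when [s = -n]. *)
Let level (s : C) : nat := (4 + Z.to_nat (up (Rabs (Re s))))%nat.

Lemma level_gt (s : C) : Rabs (Re s) + 4 < INR (level s).
Proof.
  unfold level. rewrite plus_INR. replace (INR 4) with 4 by (simpl; ring).
  destruct (archimed (Rabs (Re s))) as [H _].
  rewrite INR_IZR_INZ, Z2Nat.id; [lra|].
  apply le_IZR. pose proof (Rabs_pos (Re s)). lra.
Qed.

Lemma level_valid (s : C) : 4 < Re s + INR (S (level s)).
Proof.
  pose proof (level_gt s). rewrite S_INR.
  pose proof (Rle_abs (- Re s)) as Hr. rewrite Rabs_Ropp in Hr. lra.
Qed.

Lemma halfplane_level (K : nat) (s : C) : 3 <= Re s + INR (S K) -> halfplane (level s) s = halfplane K s.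
Proof.
  intros HK. pose proof (level_valid s) as Hl.
  destruct (Nat.le_ge_cases K (level s)) as [H|H].
  - replace (level s) with (K + (level s - K))%nat by lia. now apply halfplane_stable.
  - replace K with (level s + (K - level s))%nat by lia. symmetry. apply halfplane_stable. lra.
Qed.

Lemma rising_vanish (n m : nat) : (n < m)%nat -> rising (RtoC (- INR n)) m = 0.
Proof.
  intros H. induction H as [|m H IH]; simpl.
  - replace (RtoC (- INR n) + RtoC (INR n))%C with (RtoC 0); [ring|].
    rewrite <- RtoC_plus. f_equal. ring.
  - rewrite IH. ring.
Qed.

Theorem alternating_continuation : exists F : C -> C,
  is_entire_extension (fun s k => (RtoC ((-1) ^ k * a k) * Rcpow (INR (S k)) (- s))%C) F /\
  forall n : nat, F (RtoC (- INR n)) =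
    (RtoC (1 / 2) * shifted_sum c G (S n) (RtoC (- INR n)))%C.
Proof.
  exists (fun s => halfplane (level s) s). split; [split|].
  - apply (proj2 (entire_Cder _)). intros s.
    pose proof (level_gt s) as Hl. pose proof (level_valid s) as Hv.
    destruct (Cder_halfplane (level s) s Hv) as [l H]. exists l.
    (* [level] jumps, but on the unit disc around [s] the glued function coincides with the single
       function [halfplane (level s)]. *)
    revert H. apply @is_derive_ext_loc.
    exists (mkposreal 1 Rlt_0_1). intros w Hw.
    change (Cmod (w - s) < 1) in Hw.
    symmetry. apply halfplane_level.
    pose proof (re_le_Cmod (w - s)) as Hr. apply Rabs_le_between in Hr. simpl in Hr.
    unfold Re in *. lra.
  - intros s Hs. rewrite (halfplane_level 3).
    + apply halfplane_series; trivial; simpl INR; lra.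
    + simpl INR. lra.
  - intros n. set (s := RtoC (- INR n)).
    assert (Hn : (n <= level s)%nat).
    { apply INR_le. pose proof (level_gt s) as H. unfold s in H at 1. simpl Re in H.
      rewrite Rabs_Ropp, Rabs_pos_eq in H by apply pos_INR. lra. }
    (* The factor [s + n = 0] kills the remainder and every summand of index above [n]. *)
    unfold halfplane, remainder. rewrite (rising_vanish n (S (level s)) ltac:(lia) : rising s (S (level s)) = 0).
    replace (shifted_sum c G (S (level s)) s) with (shifted_sum c G (S n) s); [ring|].
    replace (S (level s)) with (S n + (level s - n))%nat by lia.
    generalize (level s - n)%nat; intros j. induction j; [now rewrite Nat.add_0_r|].
    rewrite Nat.add_succ_r, IHj.
    change (shifted_sum c G (S (S n + j)) s) with
      (shifted_sum c G (S n + j) s + RtoC (c (S n + j)%nat) * rising s (S n + j) * G (s + RtoC (INR (S n + j))))%C.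
    rewrite (rising_vanish n (S n + j) ltac:(lia) : rising s (S n + j) = 0). ring.
Qed.

End Continuation.

(** * Euler and Bernoulli numbers *)

Ltac Rring := match goal with |- @eq _ ?x ?y => change (@eq R x y) end; ring.

Lemma CV_radius_ge (a : nat -> R) (x : R) :
  ex_pseries a x -> Rbar_le (Rabs x) (CV_radius a).
Proof.
  intros H. apply Rbar_not_lt_le. intros Hlt.
  apply (CV_disk_outside a x Hlt). apply ex_series_lim_0. now apply ex_pseries_R.
Qed.

Lemma pseries_coef_unique (a b : nat -> R) (f : R -> R) (d : R) : 0 < d ->
  (forall t, Rabs t < d -> is_pseries a t (f t)) ->
  (forall t, Rabs t < d -> is_pseries b t (f t)) -> forall n, a n = b n.
Proof.
  intros Hd Ha Hb n.
  assert (Hh : Rabs (d / 2) < d) by (rewrite Rabs_pos_eq; lra).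
  assert (H0 : Rbar_lt 0 (Rabs (d / 2))) by (simpl; rewrite Rabs_pos_eq; lra).
  apply PSeries_ext_recip.
  - eapply Rbar_lt_le_trans; [exact H0|]. apply CV_radius_ge. eexists; now apply Ha.
  - eapply Rbar_lt_le_trans; [exact H0|]. apply CV_radius_ge. eexists; now apply Hb.
  - exists (mkposreal d Hd). intros t Ht.
    assert (Ht' : Rabs t < d).
    { change (Rabs (t - 0) < d) in Ht. now rewrite Rminus_0_r in Ht. }
    transitivity (f t); [|symmetry]; apply is_pseries_unique; auto.
Qed.

Lemma is_pseries_const (c t : R) : is_pseries (fun n => match n with O => c | _ => 0 end) t c.
Proof.
  apply is_pseries_R. apply is_series_decr_1.
  match goal with |- is_series _ ?l => replace l with 0 end.
  2:{ change (0 = c + - (c * 1)). ring. }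
  apply (is_series_ext (fun _ => 0)); [intros n; symmetry; apply Rmult_0_l|].
  apply is_series_Reals. intros eps He. exists O. intros n _.
  rewrite sum_eq_R0 by trivial. now rewrite Rdist_eq.
Qed.

Section Euler.

Variable E : nat -> R -> R.
Hypothesis HE : is_euler_polynomials E.

Definition euler_coef (n : nat) : R := E n 0 / INR (fact n).

(** The radii 3 here and 2 below stand in for [PI]: 3 follows from a bound on [PI / 2], and the gap
    gives the strict inequality on the radius of convergence. *)
Lemma euler_pseries (t : R) : Rabs t < 3 -> is_pseries euler_coef t (2 / (exp t + 1)).
Proof.
  intros Ht. apply is_pseries_R.
  assert (HPI : Rabs t < PI) by (pose proof PI2_3_2; lra).
  pose proof (HE 0 t HPI) as H. rewrite Rmult_0_l, exp_0, Rmult_1_r in H.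
  revert H. apply is_series_ext. intros n. unfold euler_coef, Rdiv. Rring.
Qed.

Lemma euler_radius (t : R) : Rabs t < 2 -> Rbar_lt (Rabs t) (CV_radius euler_coef).
Proof.
  intros Ht. apply Rbar_lt_le_trans with (Rabs 2).
  - simpl. now rewrite (Rabs_pos_eq 2) by lra.
  - apply CV_radius_ge. eexists. apply euler_pseries. rewrite Rabs_pos_eq; lra.
Qed.

Lemma exp_radius (t : R) : Rbar_lt (Rabs t) (CV_radius (fun n => / INR (fact n))).
Proof.
  apply Rbar_lt_le_trans with (Rabs (Rabs t + 1)).
  - simpl. pose proof (Rabs_pos t). rewrite (Rabs_pos_eq (Rabs t + 1)); lra.
  - apply CV_radius_ge. eexists. apply is_exp_Reals.
Qed.

Lemma euler_coef_0 : euler_coef 0 = 1.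
Proof.
  assert (H := is_pseries_unique _ _ _ (euler_pseries 0 ltac:(rewrite Rabs_R0; lra))).
  rewrite PSeries_0, exp_0 in H. lra.
Qed.

(** The two functions add up to the constant 2, so coefficients of positive index cancel. Writing
    [2 - 2 / (e^t + 1)] as [e^t * 2 / (e^t + 1)] gives the convolution identities, and as
    [2 / (e^(-t) + 1)] the parity. *)
Lemma euler_complement (a : nat -> R) (n : nat) :
  (forall t, Rabs t < 2 -> is_pseries a t (2 - 2 / (exp t + 1))) ->
  a (S n) = - euler_coef (S n).
Proof.
  intros Ha.
  assert (H : PS_plus a euler_coef (S n) = 0).
  { apply (pseries_coef_unique (PS_plus a euler_coef)
      (fun n => match n with O => 2 | _ => 0 end) (fun _ => 2) 2 ltac:(lra)).
    - intros t Ht.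
      pose proof (is_pseries_plus _ _ _ _ _ (Ha t Ht) (euler_pseries t ltac:(lra))) as H.
      change (plus (2 - 2 / (exp t + 1)) (2 / (exp t + 1))) with
        (2 - 2 / (exp t + 1) + 2 / (exp t + 1)) in H.
      replace (2 - 2 / (exp t + 1) + 2 / (exp t + 1)) with 2 in H by ring. exact H.
    - intros t _. apply is_pseries_const. }
  change (a (S n) + euler_coef (S n) = 0) in H. lra.
Qed.

Lemma euler_coef_conv_l (n : nat) :
  sum_f_R0 (fun k => / INR (fact k) * euler_coef (S n - k)) (S n) = - euler_coef (S n).
Proof.
  apply (euler_complement (PS_mult (fun n => / INR (fact n)) euler_coef)).
  intros t Ht. pose proof (exp_pos t).
  replace (2 - 2 / (exp t + 1)) with (exp t * (2 / (exp t + 1))) by (field; lra).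
  apply is_pseries_mult; [apply is_exp_Reals|apply euler_pseries; lra|apply exp_radius|now apply euler_radius].
Qed.

(** The same convolution in the other order of summation: [weight] is indexed by the power of [t],
    [shifted_sum] by the Euler coefficient. *)
Lemma euler_coef_conv_r (n : nat) :
  sum_f_R0 (fun k => euler_coef k * / INR (fact (S n - k))) (S n) = - euler_coef (S n).
Proof.
  apply (euler_complement (PS_mult euler_coef (fun n => / INR (fact n)))).
  intros t Ht. pose proof (exp_pos t).
  replace (2 - 2 / (exp t + 1)) with (2 / (exp t + 1) * exp t) by (field; lra).
  apply is_pseries_mult; [apply euler_pseries; lra|apply is_exp_Reals|now apply euler_radius|apply exp_radius].
Qed.

Lemma euler_weight (K : nat) : weight euler_coef (S K) 1 = - euler_coef (S K).
Proof.
  rewrite <- euler_coef_conv_l. unfold weight. apply sum_eq. intros i _.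
  rewrite pow1. unfold Rdiv. ring.
Qed.

Lemma euler_coef_even (n : nat) : (1 <= n)%nat -> euler_coef (2 * n) = 0.
Proof.
  intros Hn.
  assert (H : (-1) ^ (2 * n) * euler_coef (2 * n) = - euler_coef (2 * n)).
  2:{ rewrite pow_1_even in H. lra. }
  destruct (2 * n)%nat as [|m] eqn:Em; [lia|].
  apply (euler_complement (fun n => (-1) ^ n * euler_coef n)). intros t Ht. pose proof (exp_pos t) as He.
  replace (2 - 2 / (exp t + 1)) with (2 / (exp (- t) + 1)).
  2:{ rewrite exp_Ropp. field. split; lra. }
  apply is_pseries_R. pose proof (euler_pseries (- t)) as Hm. rewrite Rabs_Ropp in Hm.
  specialize (Hm ltac:(lra)). apply is_pseries_R in Hm. revert Hm. apply is_series_ext.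
  intros k. replace (- t) with (-1 * t) by ring. rewrite Rpow_mult_distr. Rring.
Qed.

(** Compare coefficients of [t^(2n)] in [2t/(e^t + 1) = 2 t/(e^t - 1) - 2 (2t)/(e^(2t) - 1)]. *)
Lemma euler_bernoulli (B : nat -> R) (n : nat) : is_bernoulli_numbers B -> (1 <= n)%nat ->
  euler_coef (2 * n - 1) = 2 * (1 - 2 ^ (2 * n)) * (B (2 * n)%nat / INR (fact (2 * n))).
Proof.
  intros [d Hd] Hn.
  assert (HB : forall t, t <> 0 -> Rabs t < d -> is_pseries (fun n => B n / INR (fact n)) t (t / (exp t - 1))).
  { intros t Ht Htd. apply is_pseries_R.
    assert (Hb : ball 0 d t) by (change (Rabs (t - 0) < d); now rewrite Rminus_0_r).
    specialize (Hd t Hb Ht). revert Hd. apply is_series_ext. intros k. unfold Rdiv; Rring. }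
  set (b := fun n => B n / INR (fact n)) in *.
  (* The Bernoulli expansion is used at [t] and at [2 * t], and both must lie within [d]. *)
  set (r := Rmin (d / 2) 1).
  assert (Hr0 : 0 < r) by (apply Rmin_pos; [pose proof (cond_pos d)|]; lra).
  assert (Hr1 : r <= d / 2) by apply Rmin_l. assert (Hr2 : r <= 1) by apply Rmin_r.
  pose proof (pseries_coef_unique (PS_incr_1 euler_coef) (fun n => 2 * (1 - 2 ^ n) * b n)
    (fun t => t * (2 / (exp t + 1))) r Hr0) as H.
  assert (H1 : PS_incr_1 euler_coef (2 * n) = 2 * (1 - 2 ^ (2 * n)) * b (2 * n)%nat).
  { apply H; clear H; intros t Ht.
    - exact (is_pseries_incr_1 euler_coef t _ (euler_pseries t ltac:(lra))).
    (* The Bernoulli expansion is given only off 0; at 0 only the coefficient of index 0 counts, and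
       [1 - 2^0 = 0]. *)
    - destruct (Req_dec t 0) as [->|Ht0].
      + rewrite Rmult_0_l. apply is_pseries_R.
        apply (is_series_ext (fun n => (match n with O => 0 | _ => 0 end) * 0 ^ n)).
        * intros [|k]; simpl; ring.
        * apply is_pseries_R. apply is_pseries_const.
      + assert (Hexp : exp t <> 1).
        { intros He. apply Ht0. rewrite <- ln_1, <- He. symmetry. apply ln_exp. }
        pose proof (exp_pos t) as Hp.
        replace (t * (2 / (exp t + 1))) with (2 * (t / (exp t - 1)) + - 2 * ((2 * t) / (exp (2 * t) - 1))).
        2:{ replace (2 * t) with (t + t) by ring. rewrite exp_plus.
            field. repeat split; try lra. nra. }
        assert (A1 := HB t Ht0 ltac:(lra)).
        assert (A2 := HB (2 * t) ltac:(lra)).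
        rewrite Rabs_mult, (Rabs_pos_eq 2) in A2 by lra. specialize (A2 ltac:(lra)).
        apply is_pseries_R in A1. apply is_pseries_R in A2. apply is_pseries_R.
        apply (is_series_scal_l 2) in A1. apply (is_series_scal_l (-2)) in A2.
        pose proof (is_series_plus _ _ _ _ A1 A2) as A3. revert A3. apply is_series_ext.
        intros k. rewrite Rpow_mult_distr.
        change (2 * (b k * t ^ k) + -2 * (b k * (2 ^ k * t ^ k)) = 2 * (1 - 2 ^ k) * b k * t ^ k). ring. }
  transitivity (PS_incr_1 euler_coef (2 * n)); [|exact H1].
  replace (2 * n)%nat with (S (2 * n - 1)) at 2 by lia. reflexivity.
Qed.

End Euler.

(** * Series identities and limits *)

(** The point 1 is on the circle of convergence, so the error is estimated directly: [ln (1 + x)]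
    minus its [n]-th Taylor sum has a derivative of modulus at most [x^(n+1)], hence modulus at most
    [1/(n+2)] at 1. *)
Lemma alternating_harmonic : is_series (fun k => (-1) ^ k / INR (S k)) (ln 2).
Proof.
  set (psum := fun n x => sum_f_R0 (fun k => (-1) ^ k * (x ^ S k / INR (S k))) n).
  assert (Hd : forall n x, 0 <= x ->
    is_derive (fun x => ln (1 + x) - psum n x) x ((-1) ^ S n * (x ^ S n / (1 + x)))).
  { intros n x Hx.
    assert (Ht : forall k, is_derive (fun x => (-1) ^ k * (x ^ S k / INR (S k))) x ((-1) ^ k * x ^ k)).
    { intros k. assert (Hk : INR (S k) <> 0) by (apply not_0_INR; lia).
      auto_derive; trivial. change (match k with O => 1 | S _ => INR k + 1 end) with (INR (S k)).
      simpl pred. field; trivial. }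
    induction n.
    - apply (is_derive_ext (fun x => ln (1 + x) - (-1) ^ 0 * (x ^ 1 / INR 1))); [reflexivity|].
      simpl. auto_derive; [lra|]. field. lra.
    - apply (is_derive_ext (fun x => (ln (1 + x) - psum n x) - (-1) ^ S n * (x ^ S (S n) / INR (S (S n))))).
      { intros y. unfold psum. rewrite tech5. Rring. }
      replace ((-1) ^ S (S n) * (x ^ S (S n) / (1 + x))) with
        ((-1) ^ S n * (x ^ S n / (1 + x)) - (-1) ^ S n * x ^ S n) by (simpl; field; lra).
      apply (is_derive_minus (K := R_AbsRing) (V := R_NormedModule) (fun x => ln (1 + x) - psum n x)
        (fun x => (-1) ^ S n * (x ^ S (S n) / INR (S (S n))))); [exact IHn|apply Ht]. }
  assert (Hp : forall n x, is_derive (fun x => x ^ S (S n) / INR (S (S n))) x (x ^ S n)).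
  { intros n x. assert (Hk : INR (S (S n)) <> 0) by (apply not_0_INR; lia).
    set (N := INR (S (S n))) in *.
    auto_derive; trivial. change (match n with O => 1 | S _ => INR n + 1 end + 1) with N.
    simpl pred. change (x ^ S n) with (x * x ^ n). field; trivial. }
  (* [h] starts at 0 and has nonnegative derivative; [g = 1] and [g = -1] give the two sides of the
     absolute value. *)
  assert (Hb : forall n g, Rabs g = 1 -> g * (ln 2 - psum n 1) <= / INR (S (S n))).
  { intros n g Hg.
    set (h := fun x => x ^ S (S n) / INR (S (S n)) - g * (ln (1 + x) - psum n x)).
    set (dh := fun x => x ^ S n - g * ((-1) ^ S n * (x ^ S n / (1 + x)))).
    assert (Hh : forall x, 0 <= x -> is_derive h x (dh x)).
    { intros x Hx.
      apply (is_derive_minus (K := R_AbsRing) (V := R_NormedModule) (fun x => x ^ S (S n) / INR (S (S n)))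
        (fun x => g * (ln (1 + x) - psum n x))); [apply Hp|].
      apply is_derive_scal. now apply Hd. }
    destruct (MVT_gen h 0 1 dh) as [x [Hx HM]].
    - intros x Hx. rewrite Rmin_left, Rmax_right in Hx by lra. apply Hh; lra.
    - intros x Hx. rewrite Rmin_left, Rmax_right in Hx by lra.
      apply continuity_pt_filterlim, (ex_derive_continuous (K := R_AbsRing) (V := R_NormedModule)).
      eexists; apply Hh; lra.
    - rewrite Rmin_left, Rmax_right in Hx by lra.
      assert (Hdh : 0 <= dh x).
      { unfold dh. assert (0 <= x ^ S n) by (apply pow_le; lra).
        assert (H1 : g * ((-1) ^ S n * (x ^ S n / (1 + x))) <= x ^ S n); [|lra].
        eapply Rle_trans; [apply Rle_abs|].
        rewrite !Rabs_mult, Hg, pow_1_abs, !Rmult_1_l. unfold Rdiv. rewrite Rabs_pos_eq.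
        - rewrite <- (Rmult_1_r (x ^ S n)) at 2. apply Rmult_le_compat_l; trivial.
          rewrite <- Rinv_1. apply Rinv_le_contravar; lra.
        - apply Rmult_le_pos; trivial. left; apply Rinv_0_lt_compat; lra. }
      assert (S0 : psum n 0 = 0).
      { unfold psum. apply sum_eq_R0. intros k _. simpl (0 ^ S k). unfold Rdiv; ring. }
      unfold h in HM. rewrite pow1, Rplus_0_r, ln_1, S0 in HM. simpl (0 ^ S (S n)) in HM.
      replace (1 + 1) with 2 in HM by ring. unfold Rdiv in HM. rewrite !Rmult_0_l in HM. lra. }
  apply is_series_Reals. intros eps He.
  destruct (archimed_cor1 eps He) as [N [HN HN0]].
  exists N. intros n Hn. unfold Rdist.
  assert (ES : sum_f_R0 (fun k => (-1) ^ k / INR (S k)) n = psum n 1).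
  { apply sum_eq. intros k _. rewrite pow1. unfold Rdiv; ring. }
  rewrite ES.
  pose proof (Hb n 1 Rabs_R1) as B1.
  pose proof (Hb n (-1) ltac:(rewrite Rabs_left; lra)) as B2.
  assert (0 < INR N) by (apply lt_0_INR; lia).
  assert (/ INR (S (S n)) <= / INR N).
  { apply Rinv_le_contravar; trivial. apply le_INR; lia. }
  apply Rabs_lt_between'. lra.
Qed.

Ltac Cring := match goal with |- @eq _ ?x ?y => change (@eq C x y) end; ring.

(** Summation by parts with [d] the difference sequence of [a]: the partial sums differ only by the
    boundary term [(-1)^n a_n phi(n+1)], which tends to zero by assumption. *)
Lemma alternating_telescope (a d : nat -> R) (phi : nat -> C) (l : C) :
  d O = a O -> (forall k, a (S k) = a k + d (S k)) ->
  (forall eps, 0 < eps -> exists N, forall n, (N <= n)%nat -> Rabs (a n) * Cmod (phi (S n)) < eps) ->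
  Cser (fun k => (RtoC ((-1) ^ k * d k) * phi k)%C) l ->
  Cser (fun k => (RtoC ((-1) ^ k * a k) * (phi k + phi (S k)))%C) l.
Proof.
  intros Hd0 HdS Hlim Hl.
  assert (E : forall n, sum_n (G := C_AbelianMonoid) (fun k => (RtoC ((-1) ^ k * a k) * (phi k + phi (S k)))%C) n =
    (sum_n (G := C_AbelianMonoid) (fun k => (RtoC ((-1) ^ k * d k) * phi k)%C) n
     + RtoC ((-1) ^ n * a n) * phi (S n))%C).
  { induction n.
    - rewrite !sum_O. rewrite Hd0. Cring.
    - rewrite !sum_Sn, IHn. rewrite HdS.
      set (u := sum_n _ n). change (plus ?x ?y) with (Cplus x y).
      set (p := phi (S n)). set (q := phi (S (S n))).
      simpl ((-1) ^ S n). rewrite !RtoC_mult, RtoC_plus.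
      replace (RtoC (-1)) with (- RtoC 1)%C by (rewrite <- RtoC_opp; reflexivity).
      set (m := RtoC ((-1) ^ n)).
      Cring. }
  apply Cser_eps. intros eps He.
  destruct (proj1 (Cser_eps _ _) Hl (eps / 2) ltac:(lra)) as [N1 H1].
  destruct (Hlim (eps / 2) ltac:(lra)) as [N2 H2].
  exists (max N1 N2). intros n Hn. specialize (H1 n ltac:(lia)). specialize (H2 n ltac:(lia)).
  rewrite E. set (u := sum_n _ n) in *.
  replace (u + RtoC ((-1) ^ n * a n) * phi (S n) - l)%C with (u - l + RtoC ((-1) ^ n * a n) * phi (S n))%C by ring.
  eapply Rle_lt_trans; [apply Cmod_triangle|].
  rewrite Cmod_mult, Cmod_R, Rabs_mult, pow_1_abs, Rmult_1_l. lra.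
Qed.

Lemma log_times_power_small (s : C) (eps : R) : 0 < Re s -> 0 < eps ->
  exists N, forall n, (N <= n)%nat ->
    (1 + ln (INR (S (S n)))) * Cmod (Rcpow (INR (S (S n))) (- s)) < eps.
Proof.
  intros Hs He. set (r := Re s) in *.
  set (A := 1 + 2 / r).
  assert (Hr : 0 < 2 / r) by (apply Rdiv_lt_0_compat; lra).
  assert (HA : 1 < A) by (unfold A; lra).
  destruct (INR_unbounded (exp (2 / r * (A / eps)))) as [N HN].
  exists N. intros n Hn.
  assert (HL : 2 / r * (A / eps) < ln (INR (S (S n)))).
  { rewrite <- (ln_exp (2 / r * (A / eps))). apply ln_increasing; [apply exp_pos|].
    eapply Rlt_le_trans; [exact HN|]. apply le_INR; lia. }
  set (L := ln (INR (S (S n)))) in *.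
  assert (HAe : 0 < A / eps) by (apply Rdiv_lt_0_compat; lra).
  assert (HL0 : 0 < L) by (assert (0 < 2 / r * (A / eps)) by (apply Rmult_lt_0_compat; lra); lra).
  rewrite Cmod_Rcpow. fold L. replace (Re (- s)) with (- r) by reflexivity.
  (* Half of the exponent absorbs the logarithm, [1 + L <= A * exp y]; the other half still makes
     the product small. *)
  set (y := r * L / 2).
  replace (- r * L) with (- y + - y) by (unfold y; field). rewrite exp_plus, exp_Ropp.
  pose proof (exp_ineq1_le y) as Hy. pose proof (exp_pos y) as Hp.
  assert (Hy0 : A / eps < y).
  { apply (Rmult_lt_compat_l (r / 2)) in HL; [|lra].
    replace (r / 2 * (2 / r * (A / eps))) with (A / eps) in HL by (field; lra). unfold y. lra. }
  assert (H1 : 1 + L <= A * exp y).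
  { replace L with (2 / r * y) by (unfold y; field; lra). unfold A.
    assert (2 / r * y <= 2 / r * exp y) by (apply Rmult_le_compat_l; lra).
    assert (1 <= exp y) by lra. lra. }
  apply Rle_lt_trans with (A * exp y * (/ exp y * / exp y)).
  - apply Rmult_le_compat_r; trivial. apply Rmult_le_pos; left; now apply Rinv_0_lt_compat.
  - replace (A * exp y * (/ exp y * / exp y)) with (A * / exp y) by (field; lra).
    apply (Rmult_lt_reg_r (exp y)); trivial. rewrite Rmult_assoc, Rinv_l, Rmult_1_r by lra.
    apply (Rmult_lt_compat_l eps) in Hy0; trivial.
    replace (eps * (A / eps)) with A in Hy0 by (field; lra).
    assert (eps * y <= eps * exp y) by (apply Rmult_le_compat_l; lra). lra.
Qed.

Lemma harmonic_S (n : nat) : harmonic (S (S n)) = harmonic (S n) + / INR (S (S n)).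
Proof.
  unfold harmonic. rewrite sum_n_Sm by lia. reflexivity.
Qed.

Lemma harmonic_1 : harmonic 1 = 1.
Proof. unfold harmonic. rewrite sum_n_n. simpl. apply Rinv_1. Qed.

(** The induction step is [1/(x+1) <= ln (x+1) - ln x], from [1 + v <= exp v] at
    [v = ln (x/(x+1))]. *)
Lemma harmonic_le_ln (n : nat) : 0 <= harmonic (S n) <= 1 + ln (INR (S n)).
Proof.
  induction n.
  - rewrite harmonic_1. simpl INR. rewrite ln_1. lra.
  - rewrite harmonic_S. pose proof (INR_S_ge_1 n) as Hn.
    replace (INR (S (S n))) with (INR (S n) + 1) by (rewrite (S_INR (S n)); ring).
    set (x := INR (S n)) in *.
    assert (0 < / (x + 1)) by (apply Rinv_0_lt_compat; lra).
    pose proof (exp_ineq1_le (ln (x / (x + 1)))) as H1.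
    assert (Hx : 0 < x / (x + 1)) by (apply Rdiv_lt_0_compat; lra).
    rewrite exp_ln in H1 by trivial. rewrite ln_div in H1 by lra.
    replace (x / (x + 1)) with (1 - / (x + 1)) in H1 by (field; lra). lra.
Qed.

Lemma harmonic_le (k : nat) : Rabs (harmonic (S k)) <= INR (S k).
Proof.
  rewrite Rabs_pos_eq by apply harmonic_le_ln.
  induction k; [rewrite harmonic_1; simpl; lra|].
  rewrite harmonic_S. pose proof (INR_S_ge_1 k).
  rewrite (S_INR (S k)). set (x := INR (S k)) in *.
  assert (/ (x + 1) <= / 1) by (apply Rinv_le_contravar; lra). lra.
Qed.

(** * Values at the non-positive integers *)

Lemma rising_neg (n m : nat) : (m <= n)%nat ->
  rising (RtoC (- INR n)) m = RtoC (INR (fact n) / INR (fact (n - m))).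
Proof.
  induction m; intros Hm.
  - simpl. rewrite Nat.sub_0_r. f_equal. field. apply INR_fact_neq_0.
  - simpl rising. rewrite IHm by lia. rewrite <- RtoC_plus, <- RtoC_opp, <- RtoC_mult. f_equal.
    replace (n - m)%nat with (S (n - S m)) by lia.
    change (fact (S (n - S m))) with (S (n - S m) * fact (n - S m))%nat. rewrite mult_INR.
    replace (- (- INR n + INR m)) with (INR (S (n - S m))).
    + field. split; [apply INR_fact_neq_0|apply not_0_INR; lia].
    + replace (S (n - S m)) with (n - m)%nat by lia. rewrite minus_INR by lia. ring.
Qed.

Lemma rising_prod (x : R) (m : nat) :
  rising (RtoC (- x)) (S m) = RtoC (prod_f_R0 (fun j => x - INR j) m).
Proof.
  induction m.
  - simpl. rewrite <- RtoC_plus, <- RtoC_opp, <- RtoC_mult. f_equal. ring.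
  - change (rising (RtoC (- x)) (S (S m))) with
      (rising (RtoC (- x)) (S m) * - (RtoC (- x) + RtoC (INR (S m))))%C.
    rewrite IHm, <- RtoC_plus, <- RtoC_opp, <- RtoC_mult. f_equal.
    change (prod_f_R0 (fun j => x - INR j) (S m)) with
      (prod_f_R0 (fun j => x - INR j) m * (x - INR (S m))). ring.
Qed.

Lemma eta_telescope (s : C) : 0 < Re s ->
  Cser (fun k => (RtoC ((-1) ^ k * 1) *
    (Rcpow (INR (S k)) (- s) + Rcpow (INR (S (S k))) (- s)))%C) 1.
Proof.
  intros Hs.
  apply (alternating_telescope (fun _ => 1) (fun k => match k with O => 1 | _ => 0 end)
    (fun k => Rcpow (INR (S k)) (- s))); trivial.
  - intros k; ring.
  - intros eps He. destruct (log_times_power_small s eps Hs He) as [N HN].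
    exists N. intros n Hn. eapply Rle_lt_trans; [|exact (HN n Hn)].
    apply Rmult_le_compat_r; [apply Cmod_ge_0|].
    rewrite Rabs_R1.
    assert (0 <= ln (INR (S (S n)))) by (rewrite <- ln_1; apply ln_le; [lra|apply INR_S_ge_1]). lra.
  - apply Cser_eps. intros eps He. exists O. intros n _.
    assert (E : sum_n (G := C_AbelianMonoid) (fun k => (RtoC ((-1) ^ k * match k with O => 1 | _ => 0 end) * Rcpow (INR (S k)) (- s))%C) n = RtoC 1).
    { induction n.
      - rewrite sum_O. simpl. unfold Rcpow. rewrite ln_1.
        replace (- s * 0)%C with (RtoC 0) by ring. rewrite Cexp_0.
        rewrite Rmult_1_l. Cring.
      - rewrite sum_Sn, IHn. rewrite Rmult_0_r. change (plus ?x ?y) with (Cplus x y). Cring. }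
    rewrite E. replace (1 - 1)%C with (RtoC 0) by ring. now rewrite Cmod_0.
Qed.

Lemma harmonic_telescope (eta : C -> C) (s : C) :
  (forall s, 0 < Re s -> Cser (eta_term s) (eta s)) -> 0 < Re s ->
  Cser (fun k => (RtoC ((-1) ^ k * harmonic (S k)) *
    (Rcpow (INR (S k)) (- s) + Rcpow (INR (S (S k))) (- s)))%C) (eta (s + 1)%C).
Proof.
  intros Heta Hs.
  apply (alternating_telescope (fun k => harmonic (S k)) (fun k => / INR (S k))
    (fun k => Rcpow (INR (S k)) (- s))).
  - rewrite harmonic_1. simpl. apply Rinv_1.
  - intros k. apply harmonic_S.
  - intros eps He. destruct (log_times_power_small s eps Hs He) as [N HN].
    exists N. intros n Hn. eapply Rle_lt_trans; [|exact (HN n Hn)].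
    apply Rmult_le_compat_r; [apply Cmod_ge_0|].
    pose proof (harmonic_le_ln n). rewrite Rabs_pos_eq by apply harmonic_le_ln.
    assert (ln (INR (S n)) <= ln (INR (S (S n)))).
    { apply ln_le; [pose proof (INR_S_ge_1 n); lra|]. apply le_INR; lia. }
    lra.
  - assert (Hs1 : 0 < Re (s + 1)) by (simpl; unfold Re in *; lra).
    pose proof (Heta (s + 1)%C Hs1) as H. revert H. apply Cser_ext. intros k.
    unfold eta_term. replace (- (s + 1))%C with (- (1) + - s)%C by ring.
    rewrite Rcpow_plus, Rcpow_opp_1 by (pose proof (INR_S_ge_1 k); lra).
    rewrite RtoC_mult. ring.
Qed.

Lemma entire_const (c : C) : entire (fun _ => c).
Proof. apply (proj2 (entire_Cder _)). intros z. eexists. cder. Qed.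

Lemma entire_shift (f : C -> C) : entire f -> entire (fun s => f (s + 1)%C).
Proof.
  intros Hf. apply (proj2 (entire_Cder _)). intros z.
  destruct (proj1 (entire_Cder f) Hf (z + 1)%C) as [l Hl]. eexists.
  refine (Cder_comp f (fun z => (z + 1)%C) _ _ _ Hl _). cder.
Qed.

Lemma is_entire_extension_unique (a b : C -> nat -> C) (f g : C -> C) :
  (forall s k, a s k = b s k) ->
  is_entire_extension a f -> is_entire_extension b g -> forall p, f p = g p.
Proof.
  intros Hab [Hf Hfs] [Hg Hgs]. apply entire_unique; trivial. intros s Hs.
  apply (Cser_unique (b s)); [|now apply Hgs].
  apply (Cser_ext (a s)); [apply Hab|now apply Hfs].
Qed.

Lemma eta_at_one (eta : C -> C) :
  (forall s, 0 < Re s -> Cser (eta_term s) (eta s)) -> eta 1 = RtoC (ln 2).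
Proof.
  intros H. apply (Cser_unique (eta_term 1)); [apply H; simpl; lra|].
  apply (Cser_ext (fun k => RtoC ((-1) ^ k / INR (S k)))).
  { intros k. unfold eta_term. rewrite Rcpow_opp_1 by (pose proof (INR_S_ge_1 k); lra).
    unfold Rdiv. apply RtoC_mult. }
  apply Cser_pair; [exact alternating_harmonic|].
  apply is_series_Reals. intros eps He. exists O. intros n _.
  rewrite sum_eq_R0 by trivial. now rewrite Rdist_eq.
Qed.

Section Values.

Variables (eta : C -> C) (E : nat -> R -> R).
Hypothesis Heta : is_entire_extension eta_term eta.
Hypothesis HE : is_euler_polynomials E.

Let c := euler_coef E.

Lemma eta_neg (n : nat) :
  eta (RtoC (- INR n)) = (RtoC (1 / 2) * shifted_sum c (fun _ => 1) (S n) (RtoC (- INR n)))%C.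
Proof.
  destruct (alternating_continuation c (fun _ => 1) (fun _ => RtoC 1) (euler_coef_0 E HE) (euler_weight E HE))
    as [F [HF HFn]].
  - intros k. rewrite Rabs_R1. apply INR_S_ge_1.
  - apply entire_const.
  - apply eta_telescope.
  - rewrite <- HFn. refine (is_entire_extension_unique _ _ _ _ _ Heta HF _).
    intros s k. unfold eta_term. now rewrite Rmult_1_r.
Qed.

Lemma eta_0 : eta 0 = RtoC (1 / 2).
Proof.
  pose proof (eta_neg 0) as H. simpl in H. rewrite Ropp_0 in H. rewrite H.
  unfold c. rewrite (euler_coef_0 E HE). ring.
Qed.

(** At [s = -N] the finite sum is [N!] times the convolution of the Euler coefficients with [1/j!],
    hence [- E_N(0)]. *)
Lemma eta_neg_S (n : nat) :
  eta (RtoC (- INR (S n))) = RtoC (- (1 / 2) * (c (S n) * INR (fact (S n)))).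
Proof.
  rewrite eta_neg.
  assert (H : forall m, (m <= S n)%nat -> shifted_sum c (fun _ => RtoC 1) (S m) (RtoC (- INR (S n))) =
    RtoC (INR (fact (S n)) * sum_f_R0 (fun k => c k * / INR (fact (S n - k))) m)).
  { induction m; intros Hm.
    - change (shifted_sum c (fun _ => RtoC 1) 1 (RtoC (- INR (S n)))) with
        (0 + RtoC (c 0%nat) * rising (RtoC (- INR (S n))) 0 * 1)%C.
      rewrite rising_neg by lia.
      change (sum_f_R0 (fun k => c k * / INR (fact (S n - k))) 0) with (c 0%nat * / INR (fact (S n - 0))).
      unfold Rdiv. rewrite !RtoC_mult. ring.
    - change (shifted_sum c (fun _ => RtoC 1) (S (S m)) (RtoC (- INR (S n)))) with
        (shifted_sum c (fun _ => RtoC 1) (S m) (RtoC (- INR (S n)))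
         + RtoC (c (S m)) * rising (RtoC (- INR (S n))) (S m) * 1)%C.
      rewrite IHm, rising_neg, tech5 by lia. unfold Rdiv.
      rewrite Rmult_plus_distr_l, RtoC_plus, !RtoC_mult. ring. }
  rewrite H by lia. unfold c at 1. rewrite (euler_coef_conv_r E HE).
  rewrite <- RtoC_mult. f_equal. fold c. ring.
Qed.

Lemma eta_neg_even (n : nat) : (1 <= n)%nat -> eta (RtoC (- INR (2 * n))) = 0.
Proof.
  intros Hn. pose proof (euler_coef_even E HE n Hn) as H0. fold c in H0.
  destruct (2 * n)%nat as [|m] eqn:Em; [lia|].
  rewrite eta_neg_S, H0. f_equal. ring.
Qed.

Lemma euler_coef_1 : c 1%nat = - (1 / 2).
Proof.
  pose proof (euler_coef_conv_r E HE 0) as H. simpl in H. fold c in H.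
  pose proof (euler_coef_0 E HE) as H0. fold c in H0. rewrite H0 in H. lra.
Qed.

Lemma entire_u_with_values : exists F : C -> C, is_entire_extension u_term F /\
  forall n, F (RtoC (- INR n)) =
    (RtoC (1 / 2) * shifted_sum c (fun s => eta (s + 1)) (S n) (RtoC (- INR n)))%C.
Proof.
  destruct (alternating_continuation c (fun k => harmonic (S k)) (fun s => eta (s + 1)%C)
    (euler_coef_0 E HE) (euler_weight E HE)) as [F [[HF HFs] HFn]].
  - exact harmonic_le.
  - apply entire_shift. apply Heta.
  - intros s Hs. apply harmonic_telescope; trivial. apply Heta.
  - exists F. split; [split; trivial|exact HFn].
    intros s Hs. specialize (HFs s Hs). revert HFs. apply Cser_ext.
    intros k. unfold u_term, eta_term. rewrite RtoC_mult. ring.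
Qed.

Variable u : C -> C.
Hypothesis Hu : is_entire_extension u_term u.

Lemma u_neg (n : nat) : u (RtoC (- INR n)) =
  (RtoC (1 / 2) * shifted_sum c (fun s => eta (s + 1)) (S n) (RtoC (- INR n)))%C.
Proof.
  destruct entire_u_with_values as [F [HF HFn]]. rewrite <- HFn.
  exact (is_entire_extension_unique _ _ _ _ (fun _ _ => eq_refl) Hu HF _).
Qed.

Lemma two_halves (z : C) : (2 * (RtoC (1 / 2) * z))%C = z.
Proof.
  rewrite Cmult_assoc, <- RtoC_mult. replace (2 * (1 / 2)) with 1 by field. ring.
Qed.

Lemma shifted_eta_step (N : nat) (s : C) :
  shifted_sum c (fun s => eta (s + 1)) (S N) s =
  (shifted_sum c (fun s => eta (s + 1)) N s + RtoC (c N) * rising s N * eta (s + RtoC (INR N) + 1))%C.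
Proof. reflexivity. Qed.

Lemma u_0 : u 0 = RtoC (1 / 2 * ln 2).
Proof.
  pose proof (u_neg 0) as H. simpl in H. rewrite Ropp_0 in H. rewrite H.
  replace (0 + 0 + 1)%C with (RtoC 1) by ring.
  rewrite (eta_at_one eta (proj2 Heta)). unfold c. rewrite (euler_coef_0 E HE), RtoC_mult. ring.
Qed.

(** Here index 0 contributes [eta(0) = 1/2] instead of a zero of [eta], so the pattern of
    [u_neg_odd] does not cover this value. *)
Lemma u_neg_1 : u (RtoC (- (1))) = RtoC (1 / 4 - 1 / 4 * ln 2).
Proof.
  change (RtoC (- (1))) with (RtoC (- INR 1)). rewrite u_neg, !shifted_eta_step.
  change (INR 0) with 0. change (INR 1) with 1.
  simpl shifted_sum. change (rising (RtoC (- (1))) 1) with (1 * - (RtoC (- (1)) + RtoC 0))%C.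
  simpl rising.
  replace (RtoC (- (1)) + RtoC 0 + 1)%C with (RtoC 0) by (apply C_ext; simpl; ring).
  replace (RtoC (- (1)) + RtoC 1 + 1)%C with (RtoC 1) by (apply C_ext; simpl; ring).
  rewrite eta_0, (eta_at_one eta (proj2 Heta)). rewrite euler_coef_1.
  unfold c; rewrite (euler_coef_0 E HE).
  apply C_ext; simpl; field.
Qed.

Lemma u_neg_even (n : nat) : (1 <= n)%nat ->
  (2 * u (RtoC (- (2 * INR n))))%C = (eta (RtoC (1 - 2 * INR n)) + RtoC (INR n * E (2 * n - 1)%nat 0))%C.
Proof.
  intros Hn.
  assert (E2 : 2 * INR n = INR (2 * n)) by (rewrite mult_INR; reflexivity).
  rewrite E2, u_neg, two_halves.
  set (s := RtoC (- INR (2 * n))).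
  assert (H : forall j, (S j <= 2 * n - 1)%nat ->
    shifted_sum c (fun s => eta (s + 1)) (S j) s = eta (RtoC (1 - INR (2 * n)))).
  { induction j; intros Hj.
    - rewrite shifted_eta_step. change (INR 0) with 0. change (rising s 0) with (RtoC 1).
      change (shifted_sum c (fun s => eta (s + 1)%C) 0 s) with (RtoC 0).
      unfold c; rewrite (euler_coef_0 E HE).
      replace (s + RtoC 0 + 1)%C with (RtoC (1 - INR (2 * n))); [ring|].
      unfold s. rewrite <- !RtoC_plus. f_equal. ring.
    - rewrite shifted_eta_step, IHj by lia.
      (* Even indices vanish through the Euler coefficient, odd ones [2p + 1 <= 2n - 2] through the
         zero of [eta] at [-2(n - p - 1)]. *)
      assert (Z : (RtoC (c (S j)) * eta (s + RtoC (INR (S j)) + 1))%C = 0).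
      { destruct (Nat.Even_or_Odd (S j)) as [[p Hp]|[p Hp]].
        - rewrite Hp. unfold c. rewrite (euler_coef_even E HE p) by lia. ring.
        - replace (s + RtoC (INR (S j)) + 1)%C with (RtoC (- INR (2 * (n - p - 1)))).
          + rewrite eta_neg_even by lia. ring.
          + unfold s. rewrite <- !RtoC_plus. f_equal. rewrite Hp.
            replace (2 * n)%nat with (2 * (n - p - 1) + (2 * p + 1) + 1)%nat by lia.
            rewrite !plus_INR. simpl (INR 1). ring. }
      set (r := rising s (S j)) in *. set (v := eta (s + RtoC (INR (S j)) + 1)%C) in *.
      replace (RtoC (c (S j)) * r * v)%C with (r * (RtoC (c (S j)) * v))%C by ring.
      rewrite Z. ring. }
  (* The top index [2n] would bring in [eta(1)], but [E_(2n)(0) = 0]; index [2n - 1] remains, with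
     [eta(0) = 1/2]. *)
  rewrite shifted_eta_step. unfold c at 2. rewrite (euler_coef_even E HE n Hn).
  replace (2 * n)%nat with (S (2 * n - 1)) at 1 by lia.
  rewrite shifted_eta_step.
  replace (2 * n - 1)%nat with (S (2 * n - 2)) at 1 by lia. rewrite H by lia.
  rewrite (rising_neg (2 * n) (2 * n - 1) ltac:(lia) : rising s (2 * n - 1) = _).
  replace (s + RtoC (INR (2 * n - 1)) + 1)%C with (RtoC 0).
  2:{ unfold s. rewrite <- !RtoC_plus. f_equal. rewrite minus_INR by lia. simpl (INR 1). ring. }
  rewrite eta_0. replace (2 * n - (2 * n - 1))%nat with 1%nat by lia.
  set (r := rising s (2 * n)). set (v := eta (s + RtoC (INR (2 * n)) + 1)%C).
  replace (RtoC 0 * r * v)%C with (RtoC 0) by ring. rewrite <- !RtoC_mult.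
  replace (c (2 * n - 1) * (INR (fact (2 * n)) / INR (fact 1)) * (1 / 2)) with (INR n * E (2 * n - 1)%nat 0).
  { ring. }
  unfold c, euler_coef.
  replace (fact (2 * n)) with (2 * n * fact (2 * n - 1))%nat.
  2:{ replace (2 * n)%nat with (S (2 * n - 1)) at 3 by lia. simpl fact.
      replace (S (2 * n - 1)) with (2 * n)%nat by lia. simpl. lia. }
  rewrite mult_INR, <- E2. simpl (fact 1). simpl (INR 1). field. apply INR_fact_neq_0.
Qed.

(** Since [eta(1 - 2n) = - E_(2n-1)(0) / 2], the previous formula is
    [2 u(-2n) = (n - 1/2) E_(2n-1)(0)]. *)
Lemma u_neg_even_bernoulli (B : nat -> R) (n : nat) : is_bernoulli_numbers B -> (1 <= n)%nat ->
  u (RtoC (- (2 * INR n))) =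
  RtoC ((2 ^ (2 * n) - 1) * (1 - 2 * INR n) / (4 * INR n) * B (2 * n)%nat).
Proof.
  intros HB Hn. pose proof (u_neg_even n Hn) as H.
  pose proof (euler_bernoulli E HE B n HB Hn) as Hc.
  assert (Hn0 : 0 < INR n) by (apply lt_0_INR; lia).
  assert (Hf : INR (fact (2 * n)) = 2 * INR n * INR (fact (2 * n - 1))).
  { replace (2 * n)%nat with (S (2 * n - 1)) at 1 by lia.
    change (fact (S (2 * n - 1))) with (S (2 * n - 1) * fact (2 * n - 1))%nat.
    rewrite mult_INR. replace (S (2 * n - 1)) with (2 * n)%nat by lia. rewrite mult_INR. reflexivity. }
  assert (He : eta (RtoC (1 - 2 * INR n)) = RtoC (- (1 / 2) * E (2 * n - 1)%nat 0)).
  { replace (1 - 2 * INR n) with (- INR (S (2 * n - 2))).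
    - rewrite eta_neg_S. f_equal. unfold c, euler_coef.
      replace (S (2 * n - 2)) with (2 * n - 1)%nat by lia. field. apply INR_fact_neq_0.
    - replace (S (2 * n - 2)) with (2 * n - 1)%nat by lia. rewrite minus_INR, mult_INR by lia. simpl; ring. }
  rewrite He, <- RtoC_plus in H.
  transitivity (RtoC (1 / 2) * (2 * u (RtoC (- (2 * INR n)))))%C.
  { rewrite Cmult_assoc, <- RtoC_mult. replace (1 / 2 * 2) with 1 by field. ring. }
  rewrite H, <- RtoC_mult. f_equal.
  unfold euler_coef in Hc. rewrite Hf in Hc.
  pose proof (INR_fact_neq_0 (2 * n - 1)) as Hf0. set (F := INR (fact (2 * n - 1))) in *.
  assert (HE2 : E (2 * n - 1)%nat 0 = 2 * (1 - 2 ^ (2 * n)) * (B (2 * n)%nat / (2 * INR n))).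
  { apply (f_equal (fun x => x * F)) in Hc. unfold Rdiv in Hc at 1.
    rewrite Rmult_assoc, Rinv_l, Rmult_1_r in Hc by trivial. rewrite Hc. field. split; trivial. lra. }
  rewrite HE2. field. lra.
Qed.

Lemma u_neg_odd (n : nat) : (2 <= n)%nat ->
  (2 * u (RtoC (1 - 2 * INR n)))%C =
  sum_n (G := C_AbelianMonoid)
    (fun m : nat =>
       Cmult
         (RtoC (prod_f_R0 (fun j => 2 * INR n - 1 - INR j) (2 * m)
                / INR (fact (2 * m + 1)) * E (2 * m + 1)%nat 0))
         (eta (RtoC (3 - 2 * INR n + 2 * INR m))))
    (n - 1).
Proof.
  intros Hn.
  set (x := 2 * INR n - 1).
  assert (Ex : x = INR (2 * n - 1)).
  { unfold x. rewrite minus_INR, mult_INR by lia. reflexivity. }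
  replace (1 - 2 * INR n) with (- INR (2 * n - 1)) by (rewrite <- Ex; unfold x; ring).
  rewrite u_neg, two_halves. rewrite <- Ex.
  replace (S (2 * n - 1)) with (2 * S (n - 1))%nat by lia.
  (* The [2n] summands are taken in pairs; the number of pairs becomes a free [p] for the induction
     while [s] keeps the fixed [n]. *)
  generalize (n - 1)%nat as p. set (s := RtoC (- x)).
  assert (Hodd : forall m, (RtoC (c (2 * m + 1)) * rising s (2 * m + 1) * eta (s + RtoC (INR (2 * m + 1)) + 1))%C =
    (RtoC (prod_f_R0 (fun j => x - INR j)%R (2 * m) / INR (fact (2 * m + 1)) * E (2 * m + 1)%nat 0) *
     eta (RtoC (3 - 2 * INR n + 2 * INR m)))%C).
  { intros m. f_equal.
    - unfold s. replace (2 * m + 1)%nat with (S (2 * m)) at 2 by lia. rewrite rising_prod, <- RtoC_mult.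
      f_equal. unfold c, euler_coef. field. apply INR_fact_neq_0.
    - f_equal. unfold s. rewrite <- !RtoC_plus. f_equal. rewrite plus_INR, mult_INR. unfold x. simpl. ring. }
  (* Index 0 vanishes because [eta(2 - 2n) = 0], which is where [2 <= n] enters. *)
  assert (Heven : forall m, (RtoC (c (2 * m)) * rising s (2 * m) * eta (s + RtoC (INR (2 * m)) + 1))%C = 0).
  { intros m. destruct m as [|m].
    - replace (s + RtoC (INR (2 * 0)) + 1)%C with (RtoC (- INR (2 * (n - 1)))).
      + rewrite eta_neg_even by lia. ring.
      + unfold s. rewrite <- !RtoC_plus. f_equal. rewrite mult_INR, minus_INR by lia. unfold x. simpl. ring.
    - unfold c. rewrite (euler_coef_even E HE) by lia. ring. }
  induction p.
  - rewrite sum_O, <- Hodd. change (2 * 1)%nat with 2%nat. rewrite !shifted_eta_step.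
    pose proof (Heven O) as H0. change (2 * 0)%nat with O in H0. rewrite H0.
    change (2 * 0 + 1)%nat with 1%nat. simpl shifted_sum. ring.
  - rewrite sum_Sn, <- IHp, <- Hodd. replace (2 * S (S p))%nat with (S (S (2 * S p))) by lia.
    rewrite !shifted_eta_step, Heven. replace (2 * S p + 1)%nat with (S (2 * S p)) by lia.
    change (plus ?x ?y) with (Cplus x y). ring.
Qed.

End Values.

Theorem theorem1 :
  forall (eta : C -> C) (E : nat -> R -> R) (B : nat -> R),
    is_dirichlet_eta eta ->
    is_euler_polynomials E ->
    is_bernoulli_numbers B ->
    (exists u : C -> C, is_entire_extension u_term u) /\
    (forall u : C -> C, is_entire_extension u_term u ->
      u (RtoC 0) = RtoC (1 / 2 * ln 2) /\
      (forall n : nat, (1 <= n)%nat ->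
        (2 * u (RtoC (- (2 * INR n))) =
           eta (RtoC (1 - 2 * INR n))
           + RtoC (INR n * E (2 * n - 1)%nat 0))%C /\
        u (RtoC (- (2 * INR n))) =
          RtoC ((2 ^ (2 * n) - 1) * (1 - 2 * INR n) / (4 * INR n)
                * B (2 * n)%nat)) /\
      u (RtoC (- (1))) = RtoC (1 / 4 - 1 / 4 * ln 2) /\
      (forall n : nat, (2 <= n)%nat ->
        (2 * u (RtoC (1 - 2 * INR n)))%C =
        sum_n (G := C_AbelianMonoid)
          (fun m : nat =>
             Cmult
               (RtoC (prod_f_R0 (fun j => 2 * INR n - 1 - INR j) (2 * m)
                      / INR (fact (2 * m + 1)) * E (2 * m + 1)%nat 0))
               (eta (RtoC (3 - 2 * INR n + 2 * INR m))))
          (n - 1))).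
Proof.
  intros eta E B [Heta _] HE HB. split.
  - destruct (entire_u_with_values eta E Heta HE) as [F [HF _]]. now exists F.
  - intros u Hu. split; [|split; [|split]].
    + exact (u_0 eta E Heta HE u Hu).
    + intros n Hn. split.
      * exact (u_neg_even eta E Heta HE u Hu n Hn).
      * exact (u_neg_even_bernoulli eta E Heta HE u Hu B n HB Hn).
    + exact (u_neg_1 eta E Heta HE u Hu).
    + exact (u_neg_odd eta E Heta HE u Hu).
Qed.
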